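(* Let $K$ be a perfectoid field, $n\ge1$, and $(r_1,\dots,r_l)\in(0,1]^l$ a $K$-free polyradius of length $l\le n$. Then $K^{\mathrm{perfd}}_{r_1,\dots,r_l}$ is a quotient field of $K\langle T_1^{1/p^\infty},\dots,T_{n+2}^{1/p^\infty}\rangle$, i.e. there is a continuous surjective $K$-algebra homomorphism from this perfectoid Tate algebra onto $K^{\mathrm{perfd}}_{r_1,\dots,r_l}$. Furthermore, there exists a field $K'$ which is a quotient field of $K\langle T_1^{1/p^\infty},\dots,T_{n+1}^{1/p^\infty}\rangle$ and such that $K^{\mathrm{perfd}}_{r_1,\dots,r_n}$ is a finite separable extension of $K'$.
   Context: $K^{\mathrm{perfd}}_{r_1,\dots,r_l}$ is the completion of $K(x_1^{1/p^\infty},\dots,x_l^{1/p^\infty})$ for the canonical extension of the $(r_1,\dots,r_l)$-Gauss norm. A polyradius is $K$-free if its entries are $\mathbb{Q}$-linearly independent in $(\mathbb{R}_{>0}/\sqrt{|K^\times|})\otimes\mathbb{Q}$. $K\langle T_1^{1/p^\infty},\dots,T_m^{1/p^\infty}\rangle$ is the perfectoid Tate algebra in $m$ variables. *)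

(* Defs.v *)
From HB Require Import structures.
From mathcomp Require Import all_boot all_order all_algebra.
From mathcomp Require Import separable.
From mathcomp Require Import reals exp.
Set Implicit Arguments. Unset Strict Implicit. Unset Printing Implicit Defensive.
Import Order.TTheory GRing.Theory Num.Theory.
Local Open Scope ring_scope.

Definition is_nonarch_abs (R : realType) (K : fieldType) (v : K -> R) : Prop :=
  [/\ forall x, 0 <= v x,
      forall x, v x = 0 -> x = 0,
      v 0 = 0,
      forall x y, v (x * y) = v x * v y
    & forall x y, v (x + y) <= Num.max (v x) (v y)].

Definition complete_wrt (R : realType) (T : zmodType) (nv : T -> R) : Prop :=
  forall u : nat -> T,
    (forall e : R, 0 < e -> exists N, forall m k, (N <= m)%N -> (N <= k)%N ->
        nv (u m - u k) < e) ->
    exists y, forall e : R, 0 < e -> exists N, forall m, (N <= m)%N -> nv (u m - y) < e.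

(* Perfectoid field (Scholze): complete for a non-archimedean absolute value
   of rank one with non-discrete value group, residue characteristic p, and
   Frobenius surjective on O_K / p. *)
Definition perfectoid_field (R : realType) (p : nat) (K : fieldType) (v : K -> R) : Prop :=
  prime p /\
  [/\ is_nonarch_abs v,
      complete_wrt v,
      (forall e : R, 0 < e -> exists x, (1 < v x) && (v x < 1 + e)),
      v (p%:R) < 1
    & forall x, v x <= 1 -> exists y, v y <= 1 /\ v (y ^+ p - x) <= v (p%:R)].

(* K-free polyradius: Q-linear independence in (R_{>0}/sqrt|K^x|) (x) Q,
   i.e. no nontrivial integral monomial in the r_i lies in sqrt|K^x|. *)
Definition K_free (R : realType) (K : fieldType) (v : K -> R) (l : nat) (r : 'I_l -> R) : Prop :=
  forall (m : 'I_l -> int) (N : nat) (x : K), (0 < N)%N -> x != 0 ->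
    (\prod_(i < l) r i ^ m i) ^+ N = v x -> forall i, m i = 0.

(* A polynomial expression in the elements t i k (thought of as T_i^{1/p^k}),
   written at the common level k with exponent vectors e (entries < D):
   sum_e a_e * prod_i (t i k)^(e i). *)
Definition poly_expr (K : fieldType) (A : comNzRingType) (iota : K -> A) (m : nat)
  (t : 'I_m -> nat -> A) (k D : nat) (a : {ffun 'I_m -> 'I_D} -> K) : A :=
  \sum_(e : {ffun 'I_m -> 'I_D}) iota (a e) * \prod_(i < m) t i k ^+ e i.

Arguments poly_expr {K A} iota {m} t k D a.

Definition gauss_val (R : realType) (p : nat) (K : fieldType) (v : K -> R) (m : nat)
  (r : 'I_m -> R) (k D : nat) (a : {ffun 'I_m -> 'I_D} -> K) : R :=
  \big[Num.max/0]_(e : {ffun 'I_m -> 'I_D})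
     (v (a e) * \prod_(i < m) (powR (r i) ((p%:R : R) ^- k)) ^+ e i).

Arguments gauss_val {R} p {K} v {m} r k D a.

(* (A, iota, nA, t) is the perfectoid Tate algebra K<T_1^{1/p^oo},...,T_m^{1/p^oo}>:
   the completion of K[T^{1/p^oo}] for the Gauss norm (radius 1), characterised
   as a complete normed K-algebra containing a compatible system of p-power roots
   t i k of T_i = t i 0, on whose polynomial expressions the norm is the Gauss
   norm, and whose polynomial expressions are dense. *)
Definition is_perfd_tate (R : realType) (p : nat) (K : fieldType) (v : K -> R) (m : nat)
  (A : comNzRingType) (iota : {rmorphism K -> A}) (nA : A -> R)
  (t : 'I_m -> nat -> A) : Prop :=
  [/\ forall x, 0 <= nA x,
          forall x, nA x = 0 -> x = 0,
          forall x y, nA (x + y) <= Num.max (nA x) (nA y),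
          forall c x, nA (iota c * x) = v c * nA x
        & forall x y, nA (x * y) <= nA x * nA y] /\
  [/\ complete_wrt nA,
      forall i k, t i k.+1 ^+ p = t i k,
      forall k D a, nA (poly_expr iota t k D a) = gauss_val p v (fun _ => 1) k D a
    & forall x (e : R), 0 < e -> exists k D a, nA (x - poly_expr iota t k D a) < e].

(* (L, iota, vL, x) is K^perfd_{r_1..r_l}: the completion of K(x_1^{1/p^oo},...,
   x_l^{1/p^oo}) for the canonical extension of the r-Gauss norm; characterised
   as a complete valued field extension of K containing compatible p-power roots
   x i k of x_i = x i 0, on whose polynomial expressions the absolute value is
   the r-Gauss norm, and in which quotients of such polynomials are dense. *)
Definition is_Kperfd (R : realType) (p : nat) (K : fieldType) (v : K -> R) (l : nat)
  (r : 'I_l -> R) (L : fieldType) (iota : {rmorphism K -> L}) (vL : L -> R)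
  (x : 'I_l -> nat -> L) : Prop :=
  is_nonarch_abs vL /\
  [/\ complete_wrt vL,
      forall c, vL (iota c) = v c,
      forall i k, x i k.+1 ^+ p = x i k,
      forall k D a, vL (poly_expr iota x k D a) = gauss_val p v r k D a
    & forall y (e : R), 0 < e -> exists k D a b,
        poly_expr iota x k D b != 0 /\
        vL (y - poly_expr iota x k D a / poly_expr iota x k D b) < e].

Definition continuous_wrt (R : realType) (A B : zmodType) (nA : A -> R) (nB : B -> R)
  (f : A -> B) : Prop :=
  forall x (e : R), 0 < e -> exists d : R, 0 < d /\
    forall y, nA (y - x) < d -> nB (f y - f x) < e.

Definition K_linear_hom (K : fieldType) (A B : comNzRingType) (iA : K -> A) (iB : K -> B)
  (f : A -> B) : Prop := forall c, f (iA c) = iB c.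

Definition finite_separable_over (L : fieldType) (F : L -> Prop) : Prop :=
  (exists s : seq L, forall y, exists c : 'I_(size s) -> L,
      (forall i, F (c i)) /\ y = \sum_(i < size s) c i * s`_i) /\
  (forall y, exists q : {poly L},
      [/\ q != 0, forall j, F q`_j, root q y & separable_poly q]).

(* Main.v *)
Require Import Defs.
From HB Require Import structures.
From mathcomp Require Import all_boot all_order all_algebra.
From mathcomp Require Import separable.
From mathcomp Require Import boolp reals exp.
From mathcomp Require Import ring lra zify.
Set Implicit Arguments. Unset Strict Implicit. Unset Printing Implicit Defensive.
Import Order.TTheory GRing.Theory Num.Theory.
Local Open Scope ring_scope.

(** Write [L] for the completed field and [x_1, ..., x_l] for its generators.
    Already [l + 1] variables suffice to surject onto [L], so in the second
    assertion one may take [K' = L].  The first [l] variables go to the [x_i]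
    and the last one to an element [s] with compatible [p]-power roots [s_k]
    which is, in the tilt, a rapidly converging series of monomials
    [pi ^ a_j * x ^ N_j].  The [j]-th monomial is chosen so that its
    [p ^ k_j]-th root is [x ^ e_j] up to a scalar, with absolute value in a
    fixed window just below [1], where [e_j] runs through all exponents in
    [Z[1/p] ^ l] and [k_j] grows fast.  The first monomial is a scalar multiple
    of [(x_1 ... x_l) ^ -1]; hence this inverse is a limit of polynomials in the
    [x_i] and [s], and every monomial whose exponents lie in [[-1, 1]] is
    approximated by the image of an element of uniformly bounded norm.
    At level [k_j] the earlier monomials of the series have such small
    exponents, so they can be subtracted from [s_{k_j}]: every [x ^ e] is
    approximated, up to a fixed factor [theta < 1], by an image of bounded norm.
    Freeness of the radius makes Laurent polynomials dense in [L], so the same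
    holds for every element of [L], and successive approximation gives
    surjectivity. *)

(** * Geometric decay and ultrametric norms *)

Lemma exprn_eventually_lt (R : realType) (theta e : R) :
  0 <= theta < 1 -> 0 < e -> exists N, forall n, (N <= n)%N -> theta ^+ n < e.
Proof.
move=> /andP[t0 t1] e0.
(* A form of Bernoulli's inequality; the slack in the induction step is
   [(n + 1) * (1 - theta) ^+ 2]. *)
have bern n : theta ^+ n * (1 + n%:R * (1 - theta)) <= 1.
  elim: n => [|n IH]; first by rewrite expr0; lra.
  apply: le_trans IH; rewrite exprSr -mulrA ler_wpM2l ?exprn_ge0 // -natr1.
  rewrite -subr_ge0.
  have -> : 1 + n%:R * (1 - theta) - theta * (1 + (n%:R + 1) * (1 - theta)) =
    (n%:R + 1) * (1 - theta) ^+ 2 by ring.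
  by rewrite mulr_ge0 ?sqr_ge0 // natr1 ler0n.
pose N := Num.bound (e * (1 - theta))^-1.
have dp : 0 < e * (1 - theta) by rewrite mulr_gt0 // subr_gt0.
have hN : 1 < N%:R * (e * (1 - theta)).
  by rewrite -ltr_pdivrMr // div1r; apply: archi_boundP; rewrite invr_ge0 ltW.
exists N => n Nn; apply: (@le_lt_trans _ _ (theta ^+ N)).
  by apply: ler_wiXn2l => //; apply: ltW.
rewrite ltNge; apply/negP => h; have := bern N.
have : 0 <= N%:R :> R by rewrite ler0n.
nra.
Qed.

Definition ultrametric_norm (R : realType) (T : zmodType) (nv : T -> R) : Prop :=
  [/\ nv 0 = 0, forall x, 0 <= nv x
    & forall x y, nv (x - y) <= Num.max (nv x) (nv y)].

Section UltrametricNorm.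
Context (R : realType) (T : zmodType) (nv : T -> R).
Hypothesis nvP : ultrametric_norm nv.

Lemma unorm0 : nv 0 = 0. Proof. by case: nvP. Qed.

Lemma unorm_ge0 x : 0 <= nv x. Proof. by case: nvP. Qed.

Lemma unormB_le c x y : nv x <= c -> nv y <= c -> nv (x - y) <= c.
Proof.
move=> xc yc; case: nvP => _ _ h; apply: (le_trans (h x y)).
by rewrite ge_max xc yc.
Qed.

Lemma unormB_lt c x y : nv x < c -> nv y < c -> nv (x - y) < c.
Proof.
move=> xc yc; case: nvP => _ _ h; apply: (le_lt_trans (h x y)).
by rewrite gt_max xc yc.
Qed.

Lemma unormN x : nv (- x) = nv x.
Proof.
have h y : nv (- y) <= nv y by rewrite -sub0r unormB_le // unorm0 unorm_ge0.
by apply/eqP; rewrite eq_le h -{1}[x]opprK h.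
Qed.

Lemma unormD_le c x y : nv x <= c -> nv y <= c -> nv (x + y) <= c.
Proof. by move=> xc yc; rewrite -[y]opprK unormB_le // unormN. Qed.

Lemma unormD_lt c x y : nv x < c -> nv y < c -> nv (x + y) < c.
Proof. by move=> xc yc; rewrite -[y]opprK unormB_lt // unormN. Qed.

Lemma unorm_distC x y : nv (x - y) = nv (y - x).
Proof. by rewrite -opprB unormN. Qed.

Lemma unorm_trans c y x z : nv (x - y) <= c -> nv (y - z) <= c -> nv (x - z) <= c.
Proof. by move=> h1 h2; rewrite -(subrKA y) unormD_le. Qed.

Lemma unorm_sum_le (I : Type) (s : seq I) (P : pred I) (F : I -> T) c :
  0 <= c -> (forall i, P i -> nv (F i) <= c) -> nv (\sum_(i <- s | P i) F i) <= c.
Proof.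
move=> c0 h; elim/big_ind: _ => //; first by rewrite unorm0.
by move=> x y; apply: unormD_le.
Qed.

Lemma unorm_sum_lt (I : Type) (s : seq I) (P : pred I) (F : I -> T) c :
  0 < c -> (forall i, P i -> nv (F i) < c) -> nv (\sum_(i <- s | P i) F i) < c.
Proof.
move=> c0 h; elim/big_ind: _ => //; first by rewrite unorm0.
by move=> x y; apply: unormD_lt.
Qed.

(** The isosceles triangle principle. *)
Lemma unorm_closest x y : nv (x - y) < nv y -> nv x = nv y.
Proof.
move=> h; apply/eqP; rewrite eq_le; apply/andP; split.
  by rewrite -[x](subrK y) unormD_le // ltW.
rewrite leNgt; apply/negP => hx.
have: nv y <= Num.max (nv x) (nv (x - y)).
  rewrite -{1}[y](subKr x) unormB_le // le_max lexx ?orbT //.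
by rewrite le_max !leNgt hx h.
Qed.

(** By the ultrametric inequality a tail is bounded by its first step, so the limit inherits the
    bound with the same [C], without a factor [1 / (1 - theta)]. If the bound failed at [k], the
    distance from [u k] to [y] would itself be an [e] contradicting convergence. *)
Lemma geometric_cauchy_limit (u : nat -> T) (C theta : R) :
  complete_wrt nv -> 0 <= C -> 0 <= theta < 1 ->
  (forall k, nv (u k.+1 - u k) <= C * theta ^+ k) ->
  exists y, forall k, nv (u k - y) <= C * theta ^+ k.
Proof.
move=> cpl C0 t01 step.
have /andP[t0 t1] := t01.
have pos k : 0 <= C * theta ^+ k by rewrite mulr_ge0 ?exprn_ge0.
have tail k m : nv (u (k + m)%N - u k) <= C * theta ^+ k.
  elim: m => [|m IH]; first by rewrite addn0 subrr unorm0.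
  apply: unorm_trans IH; rewrite addnS; apply: le_trans (step _) _.
  by rewrite ler_wpM2l // ler_wiXn2l ?leq_addr // ltW.
have small (e : R) : 0 < e -> exists N, forall n, (N <= n)%N -> C * theta ^+ n < e.
  move=> e0; have C1 : 0 < C + 1 by lra.
  have [N hN] := exprn_eventually_lt t01 (divr_gt0 e0 C1).
  exists N => n /hN; rewrite ltr_pdivlMr // mulrC => h.
  apply: le_lt_trans h; rewrite ler_wpM2r ?exprn_ge0 //; lra.
have [|y hy] := cpl u.
  move=> e e0; have [N hN] := small e e0; exists N => m k Nm Nk.
  apply: le_lt_trans (hN N (leqnn _)).
  rewrite -(subnKC Nm) -(subnKC Nk).
  by apply: (@unorm_trans _ (u N)); [|rewrite unorm_distC]; apply: tail.
exists y => k; rewrite leNgt; apply/negP => h.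
have d0 : 0 < nv (u k - y) by apply: le_lt_trans h.
have [N hN] := hy _ d0.
have := hN (k + N)%N (leq_addl _ _).
move=> h'; suff : nv (u k - y) < nv (u k - y) by rewrite ltxx.
apply: (@le_lt_trans _ _ (Num.max (nv (u k - u (k + N)%N)) (nv (u (k + N)%N - y)))).
  by apply: (@unorm_trans _ (u (k + N)%N)); rewrite le_max lexx ?orbT.
by rewrite gt_max h' andbT unorm_distC; apply: le_lt_trans (tail _ _) h.
Qed.
End UltrametricNorm.

Lemma unormM_close (R : realType) (A : comNzRingType) (nv : A -> R) (B d : R) x1 a1 x2 a2 :
  ultrametric_norm nv -> (forall x y, nv (x * y) <= nv x * nv y) ->
  0 < d <= 1 -> nv x1 + 1 <= B -> nv x2 + 1 <= B ->
  nv (x1 - a1) < d -> nv (x2 - a2) < d -> nv (x1 * x2 - a1 * a2) < d * B.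
Proof.
move=> nvP nvM /andP[d0 d1] B1 B2 h1 h2.
have p1 := unorm_ge0 nvP x1; have p2 := unorm_ge0 nvP x2.
have -> : x1 * x2 - a1 * a2 = (x1 - a1) * x2 + a1 * (x2 - a2) by ring.
apply: (unormD_lt nvP).
  apply: le_lt_trans (nvM _ _) _; apply: (@le_lt_trans _ _ (d * nv x2)).
    by rewrite ler_wpM2r // ltW.
  by rewrite ltr_pM2l //; lra.
apply: le_lt_trans (nvM _ _) _.
have a1B : nv a1 <= B.
  by rewrite -(subKr x1 a1) (unormB_le nvP) //; lra.
apply: (@le_lt_trans _ _ (B * nv (x2 - a2))); first by rewrite ler_wpM2r ?(unorm_ge0 nvP).
by rewrite mulrC ltr_pM2r //; lra.
Qed.

(** * Non-archimedean absolute values on fields *)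

Section NonarchAbs.
Context (R : realType) (F : fieldType) (w : F -> R).
Hypothesis wP : is_nonarch_abs w.

Lemma nabs_ge0 x : 0 <= w x. Proof. by case: wP. Qed.
Lemma nabs_eq0 x : w x = 0 -> x = 0. Proof. by case: wP => _ h _ _ _; apply: h. Qed.
Lemma nabs0 : w 0 = 0. Proof. by case: wP. Qed.
Lemma nabsM x y : w (x * y) = w x * w y. Proof. by case: wP. Qed.

Lemma nabs_gt0 x : x != 0 -> 0 < w x.
Proof.
by move=> x0; rewrite lt_def nabs_ge0 andbT; apply: contraNneq x0 => /nabs_eq0 ->.
Qed.

Lemma nabs1 : w 1 = 1.
Proof.
have /lt0r_neq0 h := nabs_gt0 (oner_neq0 F).
by apply: (mulfI h); rewrite -nabsM !mulr1.
Qed.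

Lemma nabsX x n : w (x ^+ n) = w x ^+ n.
Proof. by elim: n => [|n IH]; rewrite ?expr0 ?nabs1 // !exprS nabsM IH. Qed.

Lemma nabsV x : w x^-1 = (w x)^-1.
Proof.
have [->|x0] := eqVneq x 0; first by rewrite invr0 nabs0 invr0.
have /lt0r_neq0 h := nabs_gt0 x0.
by apply: (mulfI h); rewrite -nabsM !divff // nabs1.
Qed.

Lemma nabsXz x (a : int) : w (x ^ a) = w x ^ a.
Proof. by case: a => n; rewrite ?NegzE -?exprnN ?nabsV nabsX. Qed.

Lemma nabs_prod (I : Type) (s : seq I) (P : pred I) (G : I -> F) :
  w (\prod_(i <- s | P i) G i) = \prod_(i <- s | P i) w (G i).
Proof. by apply: (big_morph w nabsM nabs1). Qed.

Lemma nabsN x : w (- x) = w x.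
Proof.
suff -> : w (- x) = w (-1) * w x.
  suff -> : w (-1) = 1 by rewrite mul1r.
  by apply/eqP; rewrite -(@eqrXn2 _ 2) ?nabs_ge0 // -nabsX sqrrN !expr1n nabs1.
by rewrite -nabsM mulN1r.
Qed.

Lemma nabs_ultrametric : ultrametric_norm w.
Proof.
split; [exact: nabs0 | exact: nabs_ge0 | move=> x y].
by rewrite -(nabsN y); case: wP.
Qed.

Lemma nabs_natr_le1 n : w n%:R <= 1.
Proof.
elim: n => [|n IH]; first by rewrite nabs0.
by rewrite -natr1; apply: (unormD_le nabs_ultrametric); rewrite ?nabs1.
Qed.
End NonarchAbs.

(** * From approximate to exact compatible p-power roots *)

Section Tilting.
Context (R : realType) (p : nat) (F : fieldType) (w : F -> R) (eps : R).
Hypotheses (wP : is_nonarch_abs w) (cpl : complete_wrt w) (pr : prime p).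
Hypotheses (p_eps : w p%:R <= eps) (eps1 : eps < 1).

Let wU := nabs_ultrametric wP.
Let eps0 : 0 <= eps. Proof. exact: le_trans (nabs_ge0 wP _) p_eps. Qed.

Lemma nabsX_le1 x n : w x <= 1 -> w (x ^+ n) <= 1.
Proof. by move=> x1; rewrite (nabsX wP) exprn_ile1 // (nabs_ge0 wP). Qed.

(** Each middle binomial term is divisible by [p] and by [d]. Keeping the factor [w d] is what later
    yields contraction rather than mere additivity. *)
Lemma frobenius_additive_mod_p b d : w b <= 1 -> w d <= 1 ->
  w ((b + d) ^+ p - (b ^+ p + d ^+ p)) <= w p%:R * w d.
Proof.
move=> b1 d1; have p0 := prime_gt0 pr.
rewrite exprDn (bigD1 ord0) //= (bigD1 ord_max) /=; last by rewrite -val_eqE /= -lt0n.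
rewrite bin0 subn0 expr0 mulr1 mulr1n binn subnn expr0 mul1r mulr1n.
rewrite addrA [X in w X]addrC addrA addNr add0r.
apply: (unorm_sum_le wU) => [|i /andP[i0 im]].
  by rewrite mulr_ge0 ?(nabs_ge0 wP).
have {}i0 : (0 < i)%N by rewrite lt0n.
have {}im : (i < p)%N.
  by rewrite ltn_neqAle -ltnS ltn_ord andbT.
have /dvdnP[c ->] : (p %| 'C(p, i))%N by rewrite prime_dvd_bin // i0.
rewrite -mulr_natr natrM -(prednK i0) exprS.
have -> : b ^+ (p - i.-1.+1) * (d * d ^+ i.-1) * (c%:R * p%:R) =
  (p%:R * d) * (b ^+ (p - i.-1.+1) * (d ^+ i.-1 * c%:R)) by ring.
rewrite !(nabsM wP) ler_piMr ?mulr_ge0 ?(nabs_ge0 wP) //.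
by rewrite -!(nabsM wP) !(nabsM wP) !mulr_ile1 ?mulr_ge0 ?(nabs_ge0 wP) ?nabsX_le1
  ?(nabs_natr_le1 wP).
Qed.

Lemma frobenius_sum_mod_p (I : Type) (s : seq I) (P : pred I) (G : I -> F) :
  (forall i, P i -> w (G i) <= 1) ->
  w ((\sum_(i <- s | P i) G i) ^+ p - \sum_(i <- s | P i) G i ^+ p) <= w p%:R.
Proof.
move=> G1; elim: s => [|i s IH].
  by rewrite !big_nil expr0n gtn_eqF ?prime_gt0 // subr0 (nabs0 wP) (nabs_ge0 wP).
rewrite !big_cons; case: ifP => // Pi.
set S := \sum_(_ <- _ | _) _ in IH *; set S' := \sum_(_ <- _ | _) _ in IH *.
have S1 : w S <= 1 by apply: (unorm_sum_le wU).
apply: (@unorm_trans _ _ _ wU _ (G i ^+ p + S ^+ p)).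
  apply: le_trans (frobenius_additive_mod_p (G1 _ Pi) S1) _.
  by rewrite ler_piMr ?(nabs_ge0 wP).
by rewrite opprD addrACA subrr add0r.
Qed.

(** Put [d = a - b]. The cross terms are at most [eps * tau] by the previous estimate, and [d ^+ p]
    is at most [tau ^+ (p - 1) * tau], hence at most [eps * tau] because [p >= 2]. *)
Lemma frobenius_contracts a b tau : w b <= 1 -> tau <= eps ->
  w (a - b) <= tau -> w (a ^+ p - b ^+ p) <= eps * tau.
Proof.
move=> b1 te ab.
have t0 : 0 <= tau by apply: le_trans (nabs_ge0 wP _) ab.
have d1 : w (a - b) <= 1 by rewrite (le_trans ab) // (le_trans te) ?ltW.
have := frobenius_additive_mod_p b1 d1.
have -> : b + (a - b) = a by rewrite addrC subrK.
move=> h; rewrite -[X in w X](subrK ((a - b) ^+ p)).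
apply: (unormD_le wU).
  rewrite -addrA -opprD.
  apply: le_trans h _; apply: ler_pM => //; exact: (nabs_ge0 wP).
rewrite (nabsX wP) -(prednK (prime_gt0 pr)) exprSr.
apply: ler_pM => //; rewrite ?exprn_ge0 ?(nabs_ge0 wP) //.
have : (0 < p.-1)%N by have := prime_gt1 pr; case: (p) => [|[]].
case: p.-1 => // k _; rewrite exprS -[X in _ <= X]mulr1.
apply: ler_pM; rewrite ?exprn_ge0 ?(nabs_ge0 wP) //; first exact: le_trans te.
by rewrite exprn_ile1 ?(nabs_ge0 wP).
Qed.

Lemma iter_frobenius_contracts a b m : w b <= 1 -> w (a - b) <= eps ->
  w (a ^+ (p ^ m) - b ^+ (p ^ m)) <= eps * eps ^+ m.
Proof.
move=> b1 ab; elim: m => [|m IH]; first by rewrite expn0 !expr1 expr0 mulr1.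
rewrite expnSr !exprM exprS.
apply: frobenius_contracts => //; first exact: nabsX_le1.
by rewrite ler_piMr // exprn_ile1 // ltW.
Qed.

(* [s k] is the limit of [u (k + m) ^+ (p ^ m)]: the untilt of the class that
   the sequence [u] defines modulo [eps]. *)
Lemma compatible_roots_of_approximate (u : nat -> F) :
  (forall k, w (u k) <= 1) -> (forall k, w (u k.+1 ^+ p - u k) <= eps) ->
  exists s : nat -> F, (forall k, s k.+1 ^+ p = s k) /\ (forall k, w (s k - u k) <= eps).
Proof.
move=> u1 uS.
have step k m :
  w (u (k + m.+1)%N ^+ (p ^ m.+1) - u (k + m)%N ^+ (p ^ m)) <= eps * eps ^+ m.
  by rewrite expnS exprM addnS; apply: iter_frobenius_contracts.
have e01 : 0 <= eps < 1 by rewrite eps0.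
have lim k : exists y, forall m, w (u (k + m)%N ^+ (p ^ m) - y) <= eps * eps ^+ m.
  exact: (geometric_cauchy_limit wU (u := fun m => u (k + m)%N ^+ (p ^ m)) cpl eps0 e01).
have [s hs] := choice lim.
have su k : w (s k - u k) <= eps.
  by have := hs k 0%N; rewrite addn0 expn0 expr1 expr0 mulr1 (unorm_distC wU).
exists s; split => // k; apply/eqP; rewrite -subr_eq0; apply/eqP/(nabs_eq0 wP).
(* Both [s k.+1 ^+ p] and [s k] are close to the same element [u (k + m.+1) ^+ (p ^ m.+1)], for
   every [m]. *)
have small m : w (s k.+1 ^+ p - s k) <= eps ^+ m.
  apply: (@unorm_trans _ _ _ wU _ (u (k + m.+1)%N ^+ (p ^ m.+1))).
    rewrite expnSr exprM (unorm_distC wU).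
    have s1 : w (s k.+1) <= 1.
      by rewrite -(subrK (u k.+1) (s k.+1)) (unormD_le wU) // (le_trans (su _)) ?ltW.
    have t1 : eps * eps ^+ m <= eps by rewrite ler_piMr // exprn_ile1 // ltW.
    have := hs k.+1 m; rewrite addSnnS => /(frobenius_contracts s1 t1) h.
    apply: le_trans h _; rewrite mulrA ler_piMl ?exprn_ge0 //.
    by rewrite mulr_ile1 // ltW.
  by apply: le_trans (hs k m.+1) _; rewrite -exprS; apply: ler_wiXn2l; [exact: eps0|exact: ltW|lia].
apply/eqP; rewrite eq_le (nabs_ge0 wP) andbT leNgt; apply/negP => h.
have [N /(_ N (leqnn _))] := exprn_eventually_lt e01 h.
by rewrite ltNge small.
Qed.
End Tilting.

(** Non-discreteness of the value group supplies an element of absolute value just below 1. Iterated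
    Frobenius surjectivity gives approximate p-power roots of it, which are then made exact. *)
Lemma perfectoid_pseudo_uniformizer (R : realType) (p : nat) (K : fieldType) (v : K -> R) :
  perfectoid_field p v -> exists pi : nat -> K,
    [/\ forall k, pi k.+1 ^+ p = pi k, 0 < v (pi 0%N), v (pi 0%N) < 1
      & v p%:R <= v (pi 0%N) ^+ (p * p)].
Proof.
move=> [pr [vP cpl dense p1 frob]].
have vU := nabs_ultrametric vP.
pose e := (1 + v p%:R) / 2.
have p0 := nabs_ge0 vP p%:R.
have [e0 e1 pe] : [/\ 0 < e, e < 1 & v p%:R <= e] by rewrite /e; split; lra.
(* From [v y0 < 2 - e] and [e * (2 - e) < 1], the absolute value of [y0^-1] lies strictly between
   [e] and 1. *)
have [y0 /andP[y1 ye]] : exists y0, (1 < v y0) && (v y0 < 1 + (1 - e)).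
  by apply: dense; lra.
have vy : e < v y0^-1.
  rewrite (nabsV vP) -[X in _ < X]mul1r ltr_pdivlMr; last lra.
  by nra.
have vy1 : v y0^-1 < 1 by rewrite (nabsV vP) invf_lt1 //; lra.
have root x : exists y, v x <= 1 -> v y <= 1 /\ v (y ^+ p - x) <= v p%:R.
  have [x1|x1] := boolP (v x <= 1); last by exists 0.
  by have [y hy] := frob x x1; exists y.
have [g hg] := choice root.
pose u k := iter k g y0^-1.
have u1 k : v (u k) <= 1.
  by elim: k => [|k IH]; [apply: ltW | case: (hg _ IH)].
have uS k : v (u k.+1 ^+ p - u k) <= e.
  by case: (hg _ (u1 k)) => _ h; apply: le_trans h pe.
have [s [sS su]] := compatible_roots_of_approximate vP cpl pr pe e1 u1 uS.
have vs : v (s 0%N) = v y0^-1.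
  by apply: (unorm_closest vU); apply: le_lt_trans (su 0%N) vy.
have s2 : v (s 2) ^+ (p * p) = v y0^-1 by rewrite exprM -!(nabsX vP) !sS.
(* Dropping two levels makes [v (pi 0) ^+ (p * p)] equal to [v y0^-1], which exceeds [e] and so
   [v p]. *)
exists (fun k => s k.+2); split => //.
- apply: (nabs_gt0 vP); apply/eqP => h; move: s2; rewrite h (nabs0 vP) expr0n.
  by rewrite muln_eq0 gtn_eqF ?prime_gt0 //= => h'; move: vy; rewrite -h'; lra.
- rewrite ltNge; apply/negP => h; have := exprn_ege1 (p * p) h.
  by rewrite s2; lra.
- by rewrite s2 (le_trans pe) // ltW.
Qed.

(** * The ring of polynomial expressions in p-power roots *)

Section PolynomialExpressions.
Context (K : fieldType) (A : comNzRingType) (iota : {rmorphism K -> A}).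
Context (p m : nat) (t : 'I_m -> nat -> A).
Hypothesis tS : forall i k, t i k.+1 ^+ p = t i k.

Definition is_poly_expr (x : A) : Prop :=
  exists k D (a : {ffun 'I_m -> 'I_D} -> K), x = poly_expr iota t k D a.

Definition root_monomial (k : nat) (E : 'I_m -> nat) : A := \prod_(i < m) t i k ^+ E i.

(** A list of terms carries no degree bound and may repeat exponents, so sums and products need no
    bookkeeping of [D]. Two lists are brought to a common level by [term_sum_shift]. *)
Definition term_sum (k : nat) (s : seq (K * ('I_m -> nat))) : A :=
  \sum_(q <- s) iota q.1 * root_monomial k q.2.

Lemma compatible_rootsX i k j : t i (k + j)%N ^+ (p ^ j) = t i k.
Proof.
by elim: j => [|j IH]; rewrite ?addn0 ?expr1 // addnS expnS exprM tS IH.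
Qed.

Lemma term_sum_shift k j s : exists s', term_sum k s = term_sum (k + j) s'.
Proof.
exists [seq (q.1, fun i => (p ^ j * q.2 i)%N) | q <- s].
rewrite /term_sum big_map; apply: eq_bigr => q _; congr (_ * _).
by apply: eq_bigr => i _; rewrite exprM compatible_rootsX.
Qed.

(** Terms with equal exponent vectors are collected; [D] bounds all exponents that occur, so [inord]
    truncates nothing. *)
Lemma is_poly_expr_term_sum k s : is_poly_expr (term_sum k s).
Proof.
pose D := \max_(q <- s) \max_(i < m) q.2 i.
pose E (q : K * ('I_m -> nat)) : {ffun 'I_m -> 'I_D.+1} := [ffun i => inord (q.2 i)].
exists k, D.+1, (fun e => \sum_(q <- s | E q == e) q.1).
rewrite /term_sum /poly_expr big_seq_cond.
rewrite (partition_big E xpredT) //=; apply: eq_bigr => e _.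
rewrite rmorph_sum mulr_suml [RHS]big_seq_cond /=.
apply: eq_big => [q|q /andP[/andP[qs _] /eqP <-]]; first by rewrite andbT.
congr (_ * _); apply: eq_bigr => i _; rewrite ffunE inordK // ltnS.
by apply: leq_trans (leq_bigmax i) _; apply: leq_bigmax_seq qs _.
Qed.

Lemma poly_exprE k D (a : {ffun 'I_m -> 'I_D} -> K) :
  poly_expr iota t k D a = term_sum k [seq (a e, fun i => e i : nat) | e <- enum predT].
Proof. by rewrite /term_sum big_map big_enum. Qed.

Lemma is_poly_exprD x y : is_poly_expr x -> is_poly_expr y -> is_poly_expr (x + y).
Proof.
move=> [k [D [a ->]]] [k' [D' [a' ->]]]; rewrite !poly_exprE.
set s := map _ _; set s' := map _ _.
have [u ->] := term_sum_shift k k' s; have [u' ->] := term_sum_shift k' k s'.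
by rewrite addnC /term_sum -big_cat; apply: is_poly_expr_term_sum.
Qed.

Lemma is_poly_expr_term k c E : is_poly_expr (iota c * root_monomial k E).
Proof.
by have := is_poly_expr_term_sum k [:: (c, E)]; rewrite /term_sum big_seq1.
Qed.

Lemma is_poly_expr_const c : is_poly_expr (iota c).
Proof.
have := is_poly_expr_term 0 c (fun=> 0%N).
by rewrite /root_monomial big1 ?mulr1 // => i; rewrite expr0.
Qed.

Lemma is_poly_expr_gen i k : is_poly_expr (t i k).
Proof.
have := is_poly_expr_term k 1 (fun j => (j == i) : nat).
rewrite rmorph1 mul1r /root_monomial (bigD1 i) //= eqxx expr1 big1 ?mulr1 //.
by move=> j /negPf ->.
Qed.

Lemma is_poly_expr_sum (I : Type) (s : seq I) (P : pred I) (G : I -> A) :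
  (forall i, P i -> is_poly_expr (G i)) -> is_poly_expr (\sum_(i <- s | P i) G i).
Proof.
move=> h; elim/big_ind: _ => //; last exact: is_poly_exprD.
by rewrite -(rmorph0 iota); apply: is_poly_expr_const.
Qed.

Lemma is_poly_exprM x y : is_poly_expr x -> is_poly_expr y -> is_poly_expr (x * y).
Proof.
move=> [k [D [a ->]]] [k' [D' [a' ->]]]; rewrite !poly_exprE.
set s := map _ _; set s' := map _ _.
have [u ->] := term_sum_shift k k' s; have [u' ->] := term_sum_shift k' k s'.
rewrite addnC /term_sum mulr_suml; apply: is_poly_expr_sum => q _.
rewrite mulr_sumr; apply: is_poly_expr_sum => q' _.
rewrite mulrACA -rmorphM /root_monomial -big_split /=.
under eq_bigr do rewrite -exprD.
exact: (is_poly_expr_term _ _ (fun i => (q.2 i + q'.2 i)%N)).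
Qed.

Lemma is_poly_exprN x : is_poly_expr x -> is_poly_expr (- x).
Proof.
by move=> h; rewrite -mulN1r -(rmorphN1 iota); apply: is_poly_exprM => //;
  apply: is_poly_expr_const.
Qed.

Lemma is_poly_expr1 : is_poly_expr 1.
Proof. by rewrite -(rmorph1 iota); apply: is_poly_expr_const. Qed.

Lemma is_poly_exprX x n : is_poly_expr x -> is_poly_expr (x ^+ n).
Proof.
move=> h; elim: n => [|n IH]; first by rewrite expr0; apply: is_poly_expr1.
by rewrite exprS; apply: is_poly_exprM.
Qed.

Lemma is_poly_expr_prod (I : Type) (s : seq I) (P : pred I) (G : I -> A) :
  (forall i, P i -> is_poly_expr (G i)) -> is_poly_expr (\prod_(i <- s | P i) G i).
Proof.
move=> h; elim/big_ind: _ => //; [exact: is_poly_expr1 | exact: is_poly_exprM].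
Qed.

(** Delta coefficients isolate one monomial; the Gauss norm formula then gives the norm of each
    generator and of [1]. *)
Lemma poly_expr_delta k D (e : {ffun 'I_m -> 'I_D}) :
  poly_expr iota t k D (fun e' => (e' == e)%:R) = root_monomial k (fun i => e i).
Proof.
rewrite /poly_expr (bigD1 e) //= eqxx rmorph1 mul1r [X in _ + X]big1 ?addr0 // => e' /negPf ->.
by rewrite rmorph0 mul0r.
Qed.
End PolynomialExpressions.

Lemma gauss_val_delta (R : realType) (p : nat) (K : fieldType) (v : K -> R) (m : nat)
    (r : 'I_m -> R) k D (e : {ffun 'I_m -> 'I_D}) :
  is_nonarch_abs v ->
  gauss_val p v r k D (fun e' => (e' == e)%:R) =
    \prod_(i < m) powR (r i) ((p%:R : R) ^- k) ^+ e i.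
Proof.
move=> vP; have p0 : 0 <= \prod_(i < m) powR (r i) ((p%:R : R) ^- k) ^+ e i.
  by apply: prodr_ge0 => i _; rewrite exprn_ge0 ?powR_ge0.
apply/eqP; rewrite eq_le; apply/andP; split.
  apply: bigmax_le => // e' _; case: eqP => [->|_]; first by rewrite (nabs1 vP) mul1r.
  by rewrite (nabs0 vP) mul0r.
apply: le_trans (le_bigmax _ _ e).
by rewrite eqxx (nabs1 vP) mul1r.
Qed.

Lemma gauss_norm_gen (R : realType) (p : nat) (K : fieldType) (v : K -> R) (m : nat)
    (r : 'I_m -> R) (A : comNzRingType) (iota : {rmorphism K -> A}) (nA : A -> R)
    (t : 'I_m -> nat -> A) :
  is_nonarch_abs v ->
  (forall k D a, nA (poly_expr iota t k D a) = gauss_val p v r k D a) ->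
  forall i k, nA (t i k) = powR (r i) ((p%:R : R) ^- k).
Proof.
move=> vP gauss i k.
pose e : {ffun 'I_m -> 'I_2} := [ffun j => if j == i then lift ord0 ord0 else ord0].
have := gauss k 2%N (fun e' => (e' == e)%:R).
rewrite poly_expr_delta gauss_val_delta // /root_monomial (bigD1 i) // [RHS](bigD1 i) //=.
by rewrite ffunE eqxx !expr1 !big1 ?mulr1 // => j /negPf ji; rewrite ffunE ji expr0.
Qed.

(** * Homomorphisms out of the perfectoid Tate algebra *)

Definition pair_hom (K A B : comNzRingType) (f : K -> A) (g : K -> B) (c : K) : A * B :=
  (f c, g c).

Section PairHom.
Context (K A B : comNzRingType) (f : {rmorphism K -> A}) (g : {rmorphism K -> B}).

Fact pair_hom_is_zmod_morphism : zmod_morphism (pair_hom f g).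
Proof. by move=> a b; rewrite /pair_hom !rmorphB. Qed.

Fact pair_hom_is_monoid_morphism : monoid_morphism (pair_hom f g).
Proof. by split=> [|a b]; rewrite /pair_hom ?rmorph1 ?rmorphM. Qed.

HB.instance Definition _ :=
  GRing.isZmodMorphism.Build K (A * B)%type (pair_hom f g) pair_hom_is_zmod_morphism.
HB.instance Definition _ :=
  GRing.isMonoidMorphism.Build K (A * B)%type (pair_hom f g) pair_hom_is_monoid_morphism.
End PairHom.

Lemma rmorph_poly_expr (K : fieldType) (A B : comNzRingType) (iota : K -> A) (m : nat)
    (t : 'I_m -> nat -> A) (phi : {rmorphism A -> B}) k D a :
  phi (poly_expr iota t k D a) =
    poly_expr (fun c => phi (iota c)) (fun i k => phi (t i k)) k D a.
Proof.
rewrite /poly_expr rmorph_sum; apply: eq_bigr => e _.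
rewrite rmorphM rmorph_prod; congr (_ * _); apply: eq_bigr => i _.
by rewrite rmorphXn.
Qed.

Section TateHom.
Context (R : realType) (p : nat) (K : fieldType) (v : K -> R) (m : nat).
Context (A : comNzRingType) (iA : {rmorphism K -> A}) (nA : A -> R) (t : 'I_m -> nat -> A).
Context (L : fieldType) (iL : {rmorphism K -> L}) (vL : L -> R) (s : 'I_m -> nat -> L).
Hypotheses (vP : is_nonarch_abs v) (AP : is_perfd_tate p v iA nA t).
Hypotheses (vLP : is_nonarch_abs vL) (cplL : complete_wrt vL).
Hypotheses (vLi : forall c, vL (iL c) = v c) (sS : forall i k, s i k.+1 ^+ p = s i k).
Hypothesis s1 : forall i k, vL (s i k) <= 1.

Let vLU := nabs_ultrametric vLP.

Lemma tate_norm_ultrametric : ultrametric_norm nA.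
Proof.
case: AP => -[nA0 nAe nAD nAZ nAM] _.
have nN y : nA (- y) = nA y.
  by rewrite -mulN1r -(rmorphN1 iA) nAZ (nabsN vP) (nabs1 vP) mul1r.
split=> // [|x y]; first by rewrite -(mulr0 (iA 0)) nAZ (nabs0 vP) mul0r.
by rewrite -(nN y).
Qed.

Let nAU := tate_norm_ultrametric.

(** Evaluating one polynomial at [t] and at [s] is a single polynomial expression in [A * L], so the
    closure lemmas treat both coordinates at once. *)
Let polys (x : A) (y : L) : Prop :=
  is_poly_expr (pair_hom iA iL) (fun i k => (t i k, s i k)) (x, y).

Let tsS i k : (t i k.+1, s i k.+1) ^+ p = (t i k, s i k).
Proof.
have tS : t i k.+1 ^+ p = t i k by case: AP => _ [].
by rewrite -tS -(sS i k); elim: (p) => [|q IH]; rewrite ?expr0 // !exprS IH.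
Qed.

Let polysE x y : polys x y <->
  exists k D a, x = poly_expr iA t k D a /\ y = poly_expr iL s k D a.
Proof.
split=> -[k [D [a h]]]; exists k, D, a.
  have := congr1 fst h; have := congr1 snd h; rewrite /= => -> ->.
  by split; [apply: (rmorph_poly_expr _ _ fst)|apply: (rmorph_poly_expr _ _ snd)].
case: h => -> ->; set z := poly_expr (pair_hom _ _) _ _ _ _.
rewrite [z]surjective_pairing; congr pair; apply/esym.
  exact: (rmorph_poly_expr _ _ fst).
exact: (rmorph_poly_expr _ _ snd).
Qed.

(** As every [s i k] has absolute value at most 1, each term is bounded by its coefficient, and the
    Gauss norm of radius 1 is the largest coefficient. *)
Let polys_bound x y : polys x y -> vL y <= nA x.
Proof.
move=> /polysE[k [D [a [-> ->]]]]; case: AP => _ [_ _ -> _].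
apply: (unorm_sum_le vLU) => [|e _]; first by apply: bigmax_ge_id.
apply: le_trans (le_bigmax _ _ e).
rewrite /= [X in _ <= _ * X]big1 => [|i _]; last by rewrite powR1 expr1n.
rewrite mulr1 (nabsM vLP) vLi ler_piMr ?(nabs_ge0 vP) //.
rewrite (nabs_prod vLP); apply: prodr_ile1 => i _.
by rewrite (nabs_ge0 vLP) (nabsX_le1 vLP).
Qed.

(** The homomorphism is built as the closure of [polys]. The bound on polynomials survives in the
    closure, so an element lying over 0 vanishes and the relation is single valued. *)
Let graph (x : A) (y : L) : Prop :=
  forall e : R, 0 < e -> exists x' y', [/\ polys x' y', nA (x - x') < e & vL (y - y') < e].

Let graph_bound x y : graph x y -> vL y <= nA x.
Proof.
move=> g; apply/ler_addgt0Pr => e e0.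
have [x' [y' [/polys_bound b xx yy]]] := g e e0.
have nx : 0 <= nA x by apply: unorm_ge0.
rewrite -[y](subrK y'); apply: (unormD_le vLU); first by rewrite (le_trans (ltW yy)) // lerDr.
apply: le_trans b _; rewrite -[x'](subKr x); apply: (unormB_le nAU).
  by rewrite lerDl ltW.
by rewrite (le_trans (ltW xx)) // lerDr.
Qed.

Let graph_polys x y : polys x y -> graph x y.
Proof. by move=> h e e0; exists x, y; rewrite !subrr (unorm0 nAU) (nabs0 vLP). Qed.

Let graphB x1 y1 x2 y2 : graph x1 y1 -> graph x2 y2 -> graph (x1 - x2) (y1 - y2).
Proof.
move=> g1 g2 e e0.
have [a1 [b1 [p1 ha1 hb1]]] := g1 e e0; have [a2 [b2 [p2 ha2 hb2]]] := g2 e e0.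
exists (a1 - a2), (b1 - b2).
have p12 : polys (a1 - a2) (b1 - b2).
  by have := is_poly_exprD tsS p1 (is_poly_exprN tsS p2).
split=> //.
  have -> : x1 - x2 - (a1 - a2) = (x1 - a1) - (x2 - a2) by ring.
  exact: unormB_lt.
have -> : y1 - y2 - (b1 - b2) = (y1 - b1) - (y2 - b2) by ring.
exact: unormB_lt.
Qed.

Let graphM x1 y1 x2 y2 : graph x1 y1 -> graph x2 y2 -> graph (x1 * x2) (y1 * y2).
Proof.
move=> g1 g2 e e0.
have x1p := unorm_ge0 nAU x1; have x2p := unorm_ge0 nAU x2.
have y1p := nabs_ge0 vLP y1; have y2p := nabs_ge0 vLP y2.
pose B := nA x1 + nA x2 + vL y1 + vL y2 + 1.
have B0 : 0 < B by rewrite /B; lra.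
pose d := Num.min 1 (e / B).
have d0 : 0 < d <= 1 by rewrite lt_min ltr01 divr_gt0 //= ge_min lexx.
have dB : d * B <= e by rewrite -ler_pdivlMr // ge_min lexx orbT.
have /andP[d0' _] := d0.
have [a1 [b1 [p1 ha1 hb1]]] := g1 d d0'; have [a2 [b2 [p2 ha2 hb2]]] := g2 d d0'.
exists (a1 * a2), (b1 * b2); split.
- exact: (is_poly_exprM tsS p1 p2).
- apply: lt_le_trans dB; apply: unormM_close => //; try by rewrite /B; lra.
  by case: AP => -[].
- apply: lt_le_trans dB; apply: unormM_close => //; try by rewrite /B; lra.
  by move=> x y; rewrite (nabsM vLP).
Qed.

Let graph_uniq x y y' : graph x y -> graph x y' -> y = y'.
Proof.
move=> g g'; apply/eqP; rewrite -subr_eq0; apply/eqP/(nabs_eq0 vLP)/eqP.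
by rewrite eq_le (nabs_ge0 vLP) andbT -(unorm0 nAU) -(subrr x) graph_bound //; apply: graphB.
Qed.

Let graph_total x : exists y, graph x y.
Proof.
case: AP => _ [_ _ _ dns].
pose e n : R := n.+1%:R^-1.
have e0 n : 0 < e n by rewrite /e invr_gt0 ltr0n.
have app n : exists z, polys z.1 z.2 /\ nA (x - z.1) < e n.
  have [k [D [a h]]] := dns x (e n) (e0 n).
  exists (poly_expr iA t k D a, poly_expr iL s k D a); split=> //.
  by apply/polysE; exists k, D, a.
have [z hz] := choice app.
have small (d : R) : 0 < d -> exists N, forall n, (N <= n)%N -> e n < d.
  move=> d0; exists (Num.bound d^-1) => n Nn.
  rewrite /e -[d]invrK ltf_pV2 ?posrE ?invr_gt0 ?ltr0n //.
  apply: lt_le_trans (archi_boundP _) _; first by rewrite invr_ge0 ltW.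
  by rewrite ler_nat leqW.
(* By [polys_bound], approximations that are Cauchy in [A] have Cauchy partners in [L]. *)
have [|y hy] := cplL (u := fun n => (z n).2).
  move=> d d0; have [N hN] := small d d0; exists N => i j Ni Nj.
  case: (hz i) => pi /lt_trans/(_ (hN i Ni)) ni; case: (hz j) => pj /lt_trans/(_ (hN j Nj)) nj.
  have p12 : polys ((z i).1 - (z j).1) ((z i).2 - (z j).2).
    by have := is_poly_exprD tsS pi (is_poly_exprN tsS pj).
  apply: le_lt_trans (polys_bound p12) _.
  have -> : (z i).1 - (z j).1 = (x - (z j).1) - (x - (z i).1) by ring.
  exact: unormB_lt.
exists y => d d0; have [N hN] := small d d0; have [N' hN'] := hy d d0.
exists (z (N + N')%N).1, (z (N + N')%N).2; case: (hz (N + N')%N) => pz nz.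
split=> //; first by apply: lt_trans nz (hN _ (leq_addr _ _)).
by rewrite (unorm_distC vLU) hN' // leq_addl.
Qed.

Lemma tate_hom_exists : exists f : {rmorphism A -> L},
  [/\ forall c, f (iA c) = iL c, forall i k, f (t i k) = s i k
    & forall a, vL (f a) <= nA a].
Proof.
have [f hf] := choice graph_total.
(* Each identity for [f] holds because both sides are related by [graph] to the same element. *)
have fB : zmod_morphism f.
  by move=> x y; apply: graph_uniq (hf _) _; apply: graphB.
have fM : monoid_morphism f.
  split=> [|x y]; last by apply: graph_uniq (hf _) _; apply: graphM.
  by apply: graph_uniq (hf _) _; apply/graph_polys/is_poly_expr1.
pose f1 := GRing.isZmodMorphism.Build A L f fB.
pose f2 := GRing.isMonoidMorphism.Build A L f fM.
pose g : {rmorphism A -> L} := HB.pack f f1 f2.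
exists g; split=> [c|i k|a] /=.
- by apply: graph_uniq (hf _) _; apply/graph_polys/is_poly_expr_const.
- by apply: graph_uniq (hf _) _; apply/graph_polys/(is_poly_expr_gen _ (fun i k => (t i k, s i k)) i k).
- exact: graph_bound.
Qed.
End TateHom.

(** The remainder [y - f (S k)] is approximated again at each stage. Remainders shrink like
    [theta ^+ k] and the corrections, at most [C] times as large, sum to a preimage. *)
Lemma surjective_of_approximation (R : realType) (A : comNzRingType) (L : fieldType)
    (nA : A -> R) (vL : L -> R) (f : {rmorphism A -> L}) (C theta : R) :
  ultrametric_norm nA -> complete_wrt nA -> is_nonarch_abs vL ->
  (forall a, vL (f a) <= nA a) -> 0 <= C -> 0 <= theta < 1 ->
  (forall y, exists a, nA a <= C * vL y /\ vL (y - f a) <= theta * vL y) ->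
  forall y, exists a, f a = y.
Proof.
move=> nAU cpl vLP fb C0 t01 app y.
have vLU := nabs_ultrametric vLP; have /andP[t0 t1] := t01.
have [g hg] := choice app.
pose S := fix S k := if k is k'.+1 then S k' + g (y - f (S k')) else 0.
have err k : vL (y - f (S k)) <= vL y * theta ^+ k.
  elim: k => [|k IH]; first by rewrite rmorph0 subr0 expr0 mulr1.
  rewrite /= rmorphD opprD addrA; case: (hg (y - f (S k))) => _ h.
  by apply: le_trans h _; rewrite exprS mulrCA ler_wpM2l.
have y0 := nabs_ge0 vLP y.
have [|k|a ha] := geometric_cauchy_limit nAU (u := S) (C := C * vL y) cpl _ t01.
- exact: mulr_ge0.
- rewrite /= addrAC subrr add0r; case: (hg (y - f (S k))) => h _.
  by apply: le_trans h _; rewrite -mulrA ler_wpM2l.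
exists a; apply/eqP; rewrite -subr_eq0; apply/eqP/(nabs_eq0 vLP).
pose B := (C + 1) * vL y.
have B0 : 0 <= B by apply: mulr_ge0 => //; lra.
have small k : vL (f a - y) <= B * theta ^+ k.
  have tk : 0 <= theta ^+ k by rewrite exprn_ge0.
  apply: (@unorm_trans _ _ _ vLU _ (f (S k))); last rewrite (unorm_distC vLU).
    rewrite -rmorphB (le_trans (fb _)) // (unorm_distC nAU) (le_trans (ha k)) //.
    by rewrite ler_wpM2r // /B; nra.
  by apply: le_trans (err k) _; rewrite ler_wpM2r // /B; nra.
apply/eqP; rewrite eq_le (nabs_ge0 vLP) andbT leNgt; apply/negP => h.
have B1 : 0 < B + 1 by lra.
have [N /(_ N (leqnn _))] := exprn_eventually_lt t01 (divr_gt0 h B1).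
rewrite ltr_pdivlMr // => hN; have := small N.
have : 0 <= theta ^+ N by rewrite exprn_ge0.
by nra.
Qed.

(** * Density of Laurent polynomials *)

Section LaurentDensity.
Context (R : realType) (p : nat) (K : fieldType) (v : K -> R) (l : nat) (r : 'I_l -> R).
Context (L : fieldType) (iL : {rmorphism K -> L}) (vL : L -> R) (x : 'I_l -> nat -> L).
Hypotheses (pr : prime p) (vP : is_nonarch_abs v).
Hypotheses (r01 : forall i, (0 < r i) && (r i <= 1)) (free : K_free v r).
Hypothesis LP : is_Kperfd p v r iL vL x.

Let vLP : is_nonarch_abs vL. Proof. by case: LP. Qed.
Let vLU := nabs_ultrametric vLP.
Let vLi c : vL (iL c) = v c. Proof. by case: LP => _ []. Qed.
Let xS i k : x i k.+1 ^+ p = x i k. Proof. by case: LP => _ []. Qed.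

Lemma Kperfd_abs_gen i k : vL (x i k) = powR (r i) ((p%:R : R) ^- k).
Proof. by case: LP => _ [_ _ _ g _]; apply: (gauss_norm_gen vP g). Qed.

Lemma Kperfd_abs_genX i k : vL (x i k) ^+ (p ^ k) = r i.
Proof.
have /andP[r0 _] := r01 i.
rewrite -(nabsX vLP) -(add0n k) (compatible_rootsX xS) Kperfd_abs_gen.
by rewrite expr0 invr1 powRr1 // ltW.
Qed.

Lemma Kperfd_abs_gen_gt0 i k : 0 < vL (x i k).
Proof. by rewrite Kperfd_abs_gen powR_gt0 //; case/andP: (r01 i). Qed.

Lemma Kperfd_gen_neq0 i k : x i k != 0.
Proof.
by apply: contraTneq (Kperfd_abs_gen_gt0 i k) => ->; rewrite (nabs0 vLP) ltxx.
Qed.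

Lemma Kperfd_abs_gen_le1 i k : vL (x i k) <= 1.
Proof.
have /andP[_ r1] := r01 i.
by rewrite -(@expr_le1 _ (p ^ k)%N) ?(nabs_ge0 vLP) ?expn_gt0 ?prime_gt0 // Kperfd_abs_genX.
Qed.

Definition root_prod k := \prod_(i < l) x i k.

(** Denominators at level 0 suffice: [x i 0 / x i k] is the polynomial [x i k ^+ (p ^ k - 1)]. *)
Definition is_laurent (y : L) : Prop := exists m, is_poly_expr iL x (y * root_prod 0 ^+ m).

Lemma root_prod_neq0 k : root_prod k != 0.
Proof. by apply/prodf_neq0 => i _; apply: Kperfd_gen_neq0. Qed.

Let polyX m : is_poly_expr iL x (root_prod 0 ^+ m).
Proof.
by apply: (is_poly_exprX xS); apply: (is_poly_expr_prod xS) => i _; apply: is_poly_expr_gen.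
Qed.

Lemma is_laurent_poly y : is_poly_expr iL x y -> is_laurent y.
Proof. by exists 0%N; rewrite expr0 mulr1. Qed.

Lemma is_laurentD y z : is_laurent y -> is_laurent z -> is_laurent (y + z).
Proof.
move=> [m hy] [n hz]; exists (m + n)%N.
rewrite mulrDl exprD mulrA [X in _ + z * X]mulrC mulrA.
by apply: (is_poly_exprD xS); apply: (is_poly_exprM xS).
Qed.

Lemma is_laurentM y z : is_laurent y -> is_laurent z -> is_laurent (y * z).
Proof.
move=> [m hy] [n hz]; exists (m + n)%N.
by rewrite exprD mulrACA; apply: (is_poly_exprM xS).
Qed.

Lemma is_laurent_const c : is_laurent (iL c).
Proof. by apply/is_laurent_poly/is_poly_expr_const. Qed.

Lemma is_laurent1 : is_laurent 1.
Proof. by rewrite -(rmorph1 iL); apply: is_laurent_const. Qed.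

Lemma is_laurentX y n : is_laurent y -> is_laurent (y ^+ n).
Proof.
move=> h; elim: n => [|n IH]; first by rewrite expr0; apply: is_laurent1.
by rewrite exprS; apply: is_laurentM.
Qed.

Lemma is_laurent_sum (I : Type) (s : seq I) (P : pred I) (G : I -> L) :
  (forall i, P i -> is_laurent (G i)) -> is_laurent (\sum_(i <- s | P i) G i).
Proof.
move=> h; elim/big_ind: _ => //; last exact: is_laurentD.
by rewrite -(rmorph0 iL); apply: is_laurent_const.
Qed.

Lemma is_laurent_prod (I : Type) (s : seq I) (P : pred I) (G : I -> L) :
  (forall i, P i -> is_laurent (G i)) -> is_laurent (\prod_(i <- s | P i) G i).
Proof. by move=> h; elim/big_ind: _ => //; [exact: is_laurent1|exact: is_laurentM]. Qed.

Lemma is_laurent_genV i k : is_laurent (x i k)^-1.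
Proof.
exists 1%N; rewrite expr1 /root_prod (bigD1 i) //= mulrA.
apply: (is_poly_exprM xS); last first.
  by apply: (is_poly_expr_prod xS) => j _; apply: is_poly_expr_gen.
rewrite -(compatible_rootsX xS i 0 k) add0n.
have /prednK <- : (0 < p ^ k)%N by rewrite expn_gt0 prime_gt0.
rewrite exprS mulKf ?Kperfd_gen_neq0 //.
by apply: (is_poly_exprX xS); apply: is_poly_expr_gen.
Qed.

(* This is the only place where the freeness of the polyradius is used: the
   terms of a polynomial have pairwise distinct absolute values. *)
Lemma dominating_term k D (b : {ffun 'I_l -> 'I_D} -> K) :
  poly_expr iL x k D b != 0 ->
  exists mu, [/\ mu != 0, is_laurent mu^-1 & vL (poly_expr iL x k D b - mu) < vL mu].
Proof.
move=> Q0; pose T e := iL (b e) * root_monomial x k (fun i => e i).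
have mon0 (e : {ffun 'I_l -> 'I_D}) : root_monomial x k (fun i => e i) != 0.
  by apply/prodf_neq0 => i _; rewrite expf_neq0 // Kperfd_gen_neq0.
have absT e : vL (T e) = v (b e) * \prod_(i < l) vL (x i k) ^+ e i.
  rewrite (nabsM vLP) vLi (nabs_prod vLP); congr (_ * _).
  by apply: eq_bigr => i _; rewrite (nabsX vLP).
have inj e e' : b e != 0 -> b e' != 0 -> vL (T e) = vL (T e') -> e = e'.
  (* The [p ^ k]-th power turns the absolute values of the [x i k] into the [r i]. Two terms of
     equal size then give an integral monomial in the [r i] lying in the value group of [K]. *)
  move=> be be' /(congr1 (fun z => z ^+ (p ^ k))).
  have powT e1 : vL (T e1) ^+ (p ^ k) = v (b e1 ^+ (p ^ k)) * \prod_(i < l) r i ^+ e1 i.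
    rewrite absT exprMn -(nabsX vP) -prodrXl; congr (_ * _).
    by apply: eq_bigr => i _; rewrite exprAC Kperfd_abs_genX.
  rewrite !powT => heq.
  have /(_ 1%N ((b e' / b e) ^+ (p ^ k)) isT) h := free (m := fun i => (e i)%:Z - (e' i)%:Z).
  apply/ffunP => i; apply/val_inj/eqP; rewrite -eqz_nat -subr_eq0; apply/eqP.
  apply: h; first by rewrite expf_neq0 // mulf_neq0 // invr_neq0.
  have P0 (e1 : {ffun 'I_l -> 'I_D}) : \prod_(i < l) r i ^+ e1 i != 0.
    by apply/prodf_neq0 => j _; case/andP: (r01 j) => r0 _; rewrite expf_neq0 // gt_eqF.
  have V0 : v (b e ^+ (p ^ k)) != 0.
    by rewrite gt_eqF // (nabs_gt0 vP) // expf_neq0.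
  rewrite expr1 expr_div_n (nabsM vP) (nabsV vP).
  have -> : \prod_(i < l) r i ^ ((e i)%:Z - (e' i)%:Z) =
            \prod_(i < l) r i ^+ e i / \prod_(i < l) r i ^+ e' i.
    rewrite -prodf_div; apply: eq_bigr => j _.
    by case/andP: (r01 j) => r0 _; rewrite expfzDr ?gt_eqF // -exprnN.
  apply/eqP; rewrite eqr_div // mulrC heq; apply/eqP; ring.
have [e0 be0] : exists e0, b e0 != 0.
  case: (pickP (fun e => b e != 0)) => [e be|h]; first by exists e.
  case/eqP: Q0; rewrite /poly_expr big1 // => e _.
  by have /negbFE/eqP -> := h e; rewrite rmorph0 mul0r.
have [e1 max1] : exists e1, forall e, vL (T e) <= vL (T e1).
  case: (@arg_maxP _ _ _ e0 xpredT (fun e => vL (T e)) isT) => e1 _ h.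
  by exists e1 => e; apply: h.
have T0 e : (T e != 0) = (b e != 0) by rewrite mulf_eq0 (negPf (mon0 e)) orbF fmorph_eq0.
have T1 : 0 < vL (T e1).
  by apply: lt_le_trans (max1 e0); rewrite (nabs_gt0 vLP) // T0.
have be1 : b e1 != 0.
  by rewrite -T0; apply: contraTneq T1 => ->; rewrite (nabs0 vLP) ltxx.
exists (T e1); split; first by rewrite T0.
  rewrite invfM -fmorphV; apply: is_laurentM; first exact: is_laurent_const.
  rewrite -prodfV; apply: is_laurent_prod => i _; rewrite -exprVn.
  by apply: is_laurentX; apply: is_laurent_genV.
rewrite /poly_expr (bigD1 e1) //= addrAC subrr add0r.
apply: (unorm_sum_lt vLU) => // e ne.
have [be|be] := eqVneq (b e) 0; first by rewrite be rmorph0 mul0r (nabs0 vLP).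
rewrite lt_neqAle max1 andbT; apply: contraNneq ne => h.
by apply/eqP/inj.
Qed.

(** With [mu] the dominating term, [Q = mu * (1 - eta)] and [eta] is small, so [Q^-1] is the limit
    of the Laurent polynomials [mu^-1] times a truncated geometric series in [eta]. *)
Lemma laurent_dense y (d : R) : 0 < d -> exists2 z, is_laurent z & vL (y - z) < d.
Proof.
move=> d0; case: LP => _ [_ _ _ _ dns].
have [k [D [a [b [Q0 h]]]]] := dns y d d0.
set P := poly_expr _ _ _ _ a in h; set Q := poly_expr _ _ _ _ b in Q0 h.
have polyL c : is_laurent (poly_expr iL x k D c).
  by apply: is_laurent_poly; exists k, D, c.
have [mu [mu0 muV Qmu]] := dominating_term Q0.
pose eta := 1 - Q / mu.
have eta_l : is_laurent eta.
  apply: is_laurentD; first exact: is_laurent1.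
  rewrite -mulN1r -(rmorphN1 iL); apply: is_laurentM; first exact: is_laurent_const.
  exact: (is_laurentM (polyL b)).
have eta1 : 0 <= vL eta < 1.
  rewrite (nabs_ge0 vLP) /= /eta -(divff mu0) -mulrBl (nabsM vLP) (nabsV vLP).
  by rewrite ltr_pdivrMr ?(nabs_gt0 vLP) // mul1r (unorm_distC vLU).
(* Adding 1 keeps the divisor positive when [P] is zero. *)
have P1 : 0 < vL (P / Q) + 1 by have := nabs_ge0 vLP (P / Q); lra.
have [N /(_ N (leqnn _))] := exprn_eventually_lt eta1 (divr_gt0 d0 P1).
rewrite ltr_pdivlMr // => hN.
exists (P * (mu^-1 * \sum_(i < N) eta ^+ i)).
  apply: (is_laurentM (polyL a)); apply: is_laurentM => //.
  by apply: is_laurent_sum => i _; apply: is_laurentX.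
have key : P / Q - P * (mu^-1 * \sum_(i < N) eta ^+ i) = P / Q * eta ^+ N.
  have /eqP := subrX1 eta N; rewrite subr_eq => /eqP ->.
  set S := \sum_(i < N) _; rewrite (_ : eta - 1 = - (Q / mu)); last by rewrite /eta; ring.
  by field; rewrite mu0 Q0.
rewrite -(subrKA (P / Q)) key; apply: (unormD_lt vLU) => //.
rewrite (nabsM vLP) (nabsX vLP); apply: le_lt_trans hN.
by rewrite mulrC ler_wpM2l ?exprn_ge0 ?(nabs_ge0 vLP) // lerDl.
Qed.
End LaurentDensity.

(** * Scaling into a window and approximation by bounded elements *)

Lemma geometric_window (R : realType) (Q B xi : R) :
  0 < Q < 1 -> 0 < B -> 0 < xi -> exists a : int, B * Q < Q ^ a * xi <= B.
Proof.
move=> /andP[Q0 Q1] B0 xi0; have Q01 : 0 <= Q < 1 by rewrite ltW.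
have [N hN] := exprn_eventually_lt Q01 (divr_gt0 xi0 B0).
have hN0 := hN N (leqnn _); rewrite ltr_pdivlMr // in hN0.
(* The shift by [N] puts [g 0] above [B], so the least [n] with [g n <= B] has a predecessor, which
   is still above [B]. *)
pose g n := Q ^ (n%:Z - N%:Z) * xi.
have Qn0 : Q != 0 by rewrite gt_eqF.
have gE n : g n = Q ^+ n * (xi / Q ^+ N) by rewrite /g expfzDr // -exprnN mulrAC mulrA.
have gS n : g n.+1 = g n * Q by rewrite !gE exprS; ring.
have g0 : B < g 0%N.
  by rewrite gE expr0 mul1r ltr_pdivlMr ?exprn_gt0 // mulrC.
have ex : exists n, g n <= B.
  have P0 : 0 < xi / Q ^+ N by rewrite divr_gt0 ?exprn_gt0.
  have [n /(_ n (leqnn _)) hn] := exprn_eventually_lt Q01 (divr_gt0 B0 P0).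
  by exists n; rewrite gE -ler_pdivlMr // ltW.
case: (ex_minnP ex) => -[|n] gn min; first by move: g0; rewrite ltNge gn.
exists (n.+1%:Z - N%:Z); rewrite -/(g n.+1) gn andbT gS ltr_pM2r //.
by rewrite ltNge; apply/negP => /min; rewrite ltnn.
Qed.

Section Approximation.
Context (R : realType) (K : fieldType) (v : K -> R) (A : comNzRingType).
Context (iA : {rmorphism K -> A}) (nA : A -> R).
Context (L : fieldType) (iL : {rmorphism K -> L}) (vL : L -> R) (f : {rmorphism A -> L}).
Hypotheses (vP : is_nonarch_abs v) (vLP : is_nonarch_abs vL) (vLi : forall c, vL (iL c) = v c).
Hypotheses (nAU : ultrametric_norm nA) (nAZ : forall c x, nA (iA c * x) = v c * nA x).
Hypotheses (nAM : forall x y, nA (x * y) <= nA x * nA y) (fi : forall c, f (iA c) = iL c).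

Let vLU := nabs_ultrametric vLP.

Definition approximable (C d : R) (y : L) : Prop :=
  exists a, nA a <= C /\ vL (y - f a) <= d.

Lemma approximable_le C C' d d' y :
  C <= C' -> d <= d' -> approximable C d y -> approximable C' d' y.
Proof. by move=> hC hd [a [h1 h2]]; exists a; rewrite (le_trans h1) ?(le_trans h2). Qed.

Lemma approximableD C d y z :
  approximable C d y -> approximable C d z -> approximable C d (y + z).
Proof.
move=> [a [h1 h2]] [b [h3 h4]]; exists (a + b); split; first exact: unormD_le.
by rewrite rmorphD opprD addrACA; apply: unormD_le.
Qed.

Lemma approximable_sum C d (I : Type) (s : seq I) (P : pred I) (G : I -> L) :
  0 <= C -> 0 <= d -> (forall i, P i -> approximable C d (G i)) ->
  approximable C d (\sum_(i <- s | P i) G i).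
Proof.
move=> C0 d0 h; elim/big_ind: _ => //; last exact: approximableD.
by exists 0; rewrite rmorph0 subrr (nabs0 vLP) (unorm0 nAU).
Qed.

Lemma approximableB C d y z :
  approximable C d y -> approximable C d z -> approximable C d (y - z).
Proof.
move=> [a [h1 h2]] [b [h3 h4]]; exists (a - b); split; first exact: unormB_le.
have -> : y - z - f (a - b) = (y - f a) - (z - f b) by rewrite rmorphB; ring.
exact: unormB_le.
Qed.

Lemma approximableZ C d c y :
  approximable C d y -> approximable (v c * C) (v c * d) (iL c * y).
Proof.
move=> [a [h1 h2]]; exists (iA c * a); split.
  by rewrite nAZ ler_wpM2l ?(nabs_ge0 vP).
by rewrite rmorphM fi -mulrBr (nabsM vLP) vLi ler_wpM2l ?(nabs_ge0 vP).
Qed.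

(** The error scales with the true size of [f b], not with the bound 1, so relative errors are
    preserved. *)
Lemma approximableM C d b y : nA b <= 1 ->
  approximable C d y -> approximable C (vL (f b) * d) (f b * y).
Proof.
move=> b1 [a [h1 h2]]; exists (b * a); split.
  apply: le_trans (nAM _ _) _; apply: le_trans h1.
  by rewrite ler_piMl // unorm_ge0.
by rewrite rmorphM -mulrBr (nabsM vLP) ler_wpM2l ?(nabs_ge0 vLP).
Qed.
End Approximation.

Section SubmultiplicativeNorm.
Context (R : realType) (A : comNzRingType) (nA : A -> R).
Hypotheses (nA0 : forall x, 0 <= nA x) (nA1 : nA 1 <= 1).
Hypothesis nAM : forall x y, nA (x * y) <= nA x * nA y.

Lemma snormM_le1 x y : nA x <= 1 -> nA y <= 1 -> nA (x * y) <= 1.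
Proof. by move=> x1 y1; apply: le_trans (nAM _ _) _; rewrite mulr_ile1. Qed.

Lemma snormX_le1 x n : nA x <= 1 -> nA (x ^+ n) <= 1.
Proof. by move=> x1; elim: n => [|n IH]; rewrite ?expr0 // exprS snormM_le1. Qed.

Lemma snorm_prod_le1 (I : Type) (s : seq I) (P : pred I) (G : I -> A) :
  (forall i, P i -> nA (G i) <= 1) -> nA (\prod_(i <- s | P i) G i) <= 1.
Proof. by move=> h; elim/big_ind: _ => //; apply: snormM_le1. Qed.
End SubmultiplicativeNorm.

(** * The series of monomials defining the last generator *)

Section Generators.
Context (R : realType) (p : nat) (K : fieldType) (v : K -> R) (l : nat) (r : 'I_l -> R).
Context (L : fieldType) (iL : {rmorphism K -> L}) (vL : L -> R) (x : 'I_l -> nat -> L).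
Hypotheses (pr : prime p) (vP : is_nonarch_abs v).
Hypotheses (r01 : forall i, (0 < r i) && (r i <= 1)) (free : K_free v r).
Hypothesis LP : is_Kperfd p v r iL vL x.

Let vLP : is_nonarch_abs vL. Proof. by case: LP. Qed.
Let vLU := nabs_ultrametric vLP.
Let vLi c : vL (iL c) = v c. Proof. by case: LP => _ []. Qed.
Let xS i k : x i k.+1 ^+ p = x i k. Proof. by case: LP => _ []. Qed.
Let p0 : (0 < p)%N. Proof. exact: prime_gt0. Qed.

(* The index [(k, e, m)] stands for the monomial with exponents
   [e i / p ^ k - m]; its [p ^ h]-th root is [monomial_root (k, e, m) h]. *)
Definition monomial_index : countType := (nat * {ffun 'I_l -> nat} * nat)%type.

Definition monomial_root (q : monomial_index) (h : nat) : L :=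
  root_monomial x (q.1.1 + h) q.1.2 / root_prod x h ^+ q.2.

Lemma root_prodS h : root_prod x h.+1 ^+ p = root_prod x h.
Proof. by rewrite /root_prod -prodrXl; apply: eq_bigr => i _; rewrite xS. Qed.

Lemma root_prodX h : root_prod x h ^+ (p ^ h) = root_prod x 0.
Proof.
by rewrite /root_prod -prodrXl; apply: eq_bigr => i _; rewrite -{1}(add0n h) (compatible_rootsX xS).
Qed.

Lemma monomial_rootS q h : monomial_root q h.+1 ^+ p = monomial_root q h.
Proof.
rewrite /monomial_root expr_div_n exprAC root_prodS; congr (_ / _).
by rewrite /root_monomial -prodrXl; apply: eq_bigr => i _; rewrite exprAC addnS xS.
Qed.

Lemma monomial_root_neq0 q h : monomial_root q h != 0.
Proof.
rewrite mulf_neq0 ?invr_neq0 ?expf_neq0 ?(root_prod_neq0 vP r01 LP) //.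
by apply/prodf_neq0 => i _; rewrite expf_neq0 ?(Kperfd_gen_neq0 vP r01 LP).
Qed.

Definition index_size (q : monomial_index) : nat := (\max_(i < l) q.1.2 i + q.2)%N.

Context (pi : nat -> K).
Hypotheses (piS : forall k, pi k.+1 ^+ p = pi k) (pi_gt0 : 0 < v (pi 0%N)).
Hypotheses (pi_lt1 : v (pi 0%N) < 1) (pi_p : v p%:R <= v (pi 0%N) ^+ (p * p)).

Let Q := v (pi 0%N).
(** Terms will lie between [Q ^+ p.+1] and [Q ^+ p]. Their p-th powers are at most [eps], so they
    disappear modulo [eps] after one Frobenius, whereas [p + 1 < p * p] keeps the terms themselves
    larger than [eps]. *)
Let eps := Q ^+ (p * p).

Context (idx : nat -> monomial_index) (ex : nat -> int).

Definition gterm (j h : nat) : L := iL (pi h ^ ex j) * monomial_root (idx j) h.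

Hypothesis gterm_window : forall j, Q ^+ p.+1 < vL (gterm j 0) <= Q ^+ p.

(** The level at which term [j] enters. The gap after it exceeds the size of its index, so by the
    time a later term enters, the exponents of its root lie in [[-1, 1]]. *)
Fixpoint level (j : nat) : nat :=
  if j is j'.+1 then (level j' + (index_size (idx j')).+1)%N else 0%N.

Lemma gtermS j h : gterm j h.+1 ^+ p = gterm j h.
Proof.
rewrite /gterm exprMn monomial_rootS -rmorphXn; congr (iL _ * _).
by rewrite -(piS h) !exprnP !exprz_exp mulrC.
Qed.

Lemma gtermX j h : gterm j h ^+ (p ^ h) = gterm j 0.
Proof.
by elim: h => [|h IH]; rewrite ?expr1 // expnS exprM gtermS IH.
Qed.

Lemma gterm_le1 j h : vL (gterm j h) <= 1.
Proof.
rewrite -(@expr_le1 _ (p ^ h)%N) ?expn_gt0 ?p0 ?(nabs_ge0 vLP) // -(nabsX vLP) gtermX.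
by case/andP: (gterm_window j) => _ h1; rewrite (le_trans h1) // exprn_ile1 // ltW.
Qed.

Lemma level_ltn i j : (i < j)%N -> (level i + index_size (idx i) < level j)%N.
Proof.
elim: j => // j IH; rewrite ltnS leq_eqVlt => /predU1P[->|/IH] /=; lia.
Qed.

Lemma leq_level j : (j <= level j)%N.
Proof. by elim: j => //= j IH; lia. Qed.

Lemma level_inj_leq i j : (level i <= level j)%N -> i != j -> (i < j)%N.
Proof.
by move=> h ij; rewrite ltnNge; apply/negP => ji; have := @level_ltn j i; lia.
Qed.

(** In the tilt, term [j] of the series is the [p ^ level j]-th power of the element with roots
    [gterm j]; the [p ^ k]-th root of the series keeps, modulo [eps], the terms of level at most
    [k]. The range [j < k.+1] misses none, since [j <= level j]. *)
Definition partial_sum (k : nat) : L :=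
  \sum_(j < k.+1 | (level j <= k)%N) gterm j (k - level j).

Lemma partial_sum_le1 k : vL (partial_sum k) <= 1.
Proof. by apply: (unorm_sum_le vLU) => // j _; apply: gterm_le1. Qed.

(** Modulo [p], Frobenius acts term by term and moves each root back one level. What remains are the
    terms of level exactly [k.+1], whose p-th powers are at most [eps]. *)
Lemma partial_sum_frobenius k : vL (partial_sum k.+1 ^+ p - partial_sum k) <= eps.
Proof.
have pL : vL p%:R <= eps by rewrite -(rmorph_nat iL) vLi.
have e0 : 0 <= eps by apply: exprn_ge0; apply: ltW.
pose S := \sum_(j < k.+2 | (level j <= k.+1)%N) gterm j (k.+1 - level j) ^+ p.
apply: (@unorm_trans _ _ _ vLU _ S).
  apply: le_trans pL; apply: (frobenius_sum_mod_p vLP pr) => j _; exact: gterm_le1.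
have -> : partial_sum k = \sum_(j < k.+2 | (level j <= k)%N) gterm j (k.+1 - level j) ^+ p.
  (* The additional index [k.+1] has level above [k] and is filtered out. *)
  rewrite /partial_sum [RHS]big_mkcond big_ord_recr ifF ?Monoid.mulm1; last first.
    by apply/negbTE; rewrite -ltnNge; apply: (leq_level k.+1).
  rewrite -big_mkcond /=; apply: eq_bigr => j jk.
  by rewrite subSn // gtermS.
rewrite /S (bigID (fun j : 'I_k.+2 => (level j <= k)%N)) /=.
rewrite (eq_bigl (fun j : 'I_k.+2 => (level j <= k)%N)); last by move=> j; lia.
rewrite addrAC subrr add0r; apply: (unorm_sum_le vLU) => // j /andP[h1 h2].
have -> : (k.+1 - level j = 0)%N by lia.
rewrite (nabsX vLP) /eps exprM; case/andP: (gterm_window j) => _ h.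
by apply: lerXn2r; rewrite ?nnegrE ?(nabs_ge0 vLP) ?exprn_ge0 ?(ltW pi_gt0).
Qed.

Lemma universal_root_exists : exists s : nat -> L,
  [/\ forall k, s k.+1 ^+ p = s k, forall k, vL (s k) <= 1
    & forall k, vL (s k - partial_sum k) <= eps].
Proof.
have pL : vL p%:R <= eps by rewrite -(rmorph_nat iL) vLi.
have e1 : eps < 1.
  by rewrite expr_lt1 ?(ltW pi_gt0) // muln_gt0 p0.
have cpl : complete_wrt vL by case: LP => _ [].
have [s [sS su]] := compatible_roots_of_approximate vLP cpl pr pL e1
  partial_sum_le1 partial_sum_frobenius.
exists s; split=> // k.
rewrite -[s k](subrK (partial_sum k)) (unormD_le vLU) ?partial_sum_le1 //.
by rewrite (le_trans (su k)) // ltW.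
Qed.

(** * Approximation of monomials and surjectivity *)

Context (A : comNzRingType) (iA : {rmorphism K -> A}) (nA : A -> R) (f : {rmorphism A -> L}).
Context (T : 'I_l -> nat -> A) (S : nat -> A) (s : nat -> L).
Hypotheses (nAU : ultrametric_norm nA) (nAZ : forall c y, nA (iA c * y) = v c * nA y).
Hypotheses (nAM : forall y z, nA (y * z) <= nA y * nA z) (nA1 : nA 1 <= 1).
Hypotheses (cplA : complete_wrt nA) (fi : forall c, f (iA c) = iL c).
Hypotheses (fT : forall i k, f (T i k) = x i k) (fS : forall k, f (S k) = s k).
Hypotheses (T1 : forall i k, nA (T i k) <= 1) (S1 : forall k, nA (S k) <= 1).
Hypotheses (fb : forall a, vL (f a) <= nA a).
Hypothesis s_close : forall k, vL (s k - partial_sum k) <= eps.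
Hypotheses (idx0 : idx 0 = (0%N, [ffun=> 0%N], 1%N)) (idx_onto : forall q, exists j, idx j = q).

Let X := root_prod x 0.
Let eps_gt0 : 0 < eps. Proof. exact: exprn_gt0. Qed.
Let X0 : X != 0. Proof. exact: (root_prod_neq0 vP r01 LP). Qed.
Let app := approximable nA vL f.
Let nA0 y : 0 <= nA y. Proof. exact: unorm_ge0. Qed.

Lemma eps_lt_window : eps < Q ^+ p.+1.
Proof. by rewrite ltr_iXn2l //; have := prime_gt1 pr; nia. Qed.

(** At level 0 only the term [d / X] is present, so [y = d^-1 * s 0 * X] is close to 1. Then
    [X^-1 = d^-1 * s 0 / y], and expanding [1 / y] geometrically gives images of polynomials in [S]
    and [T]. *)
Lemma root_prod_inv_approximable : exists C0, app C0 (eps * vL X^-1) X^-1.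
Proof.
pose d := pi 0%N ^ ex 0%N.
have u0 : partial_sum 0 = iL d / X.
  rewrite /partial_sum big_mkcond big_ord1 /= /gterm /monomial_root idx0 /= expr1.
  rewrite /root_monomial big1 ?mul1r // => i _; by rewrite ffunE expr0.
have d0 : d != 0.
  by rewrite expfz_neq0 //; apply: contraTneq pi_gt0 => ->; rewrite (nabs0 vP) ltxx.
have iLd0 : iL d != 0 by rewrite fmorph_eq0.
pose y := (iL d)^-1 * s 0%N * X.
have y1 : 0 <= vL (1 - y) < 1.
  rewrite (nabs_ge0 vLP) /=.
  have -> : 1 - y = (partial_sum 0 - s 0%N) / partial_sum 0.
    by rewrite u0 /y; field; rewrite X0 iLd0.
  have ug : Q ^+ p.+1 < vL (partial_sum 0).
    by rewrite /partial_sum big_mkcond big_ord1 /=; case/andP: (gterm_window 0).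
  have up : 0 < vL (partial_sum 0) by apply: lt_trans ug; apply: exprn_gt0.
  rewrite (nabsM vLP) (nabsV vLP) ltr_pdivrMr // mul1r (unorm_distC vLU).
  by apply: le_lt_trans (s_close 0) _; apply: lt_trans ug; apply: eps_lt_window.
have [N /(_ N (leqnn _)) hN] := exprn_eventually_lt y1 eps_gt0.
pose b := iA d^-1 * S 0%N.
pose a := b * \sum_(i < N) (1 - b * \prod_(i < l) T i 0%N) ^+ i.
exists (nA a), a; split=> //.
have fbE : f b = (iL d)^-1 * s 0%N by rewrite rmorphM fi fS fmorphV.
have -> : f a = (iL d)^-1 * s 0%N * \sum_(i < N) (1 - y) ^+ i.
  rewrite rmorphM fbE rmorph_sum; congr (_ * _); apply: eq_bigr => i _.
  rewrite rmorphXn rmorphB rmorph1 rmorphM fbE rmorph_prod; congr ((1 - _ * _) ^+ _).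
  by apply: eq_bigr => j _; rewrite fT.
have -> : X^-1 - (iL d)^-1 * s 0%N * \sum_(i < N) (1 - y) ^+ i = X^-1 * (1 - y) ^+ N.
  have /eqP := subrX1 (1 - y) N; rewrite subr_eq => /eqP ->.
  set Sg := \sum_(i < N) _; rewrite (_ : 1 - y - 1 = - y); last by ring.
  by rewrite /y; field; rewrite X0 iLd0.
by rewrite (nabsM vLP) mulrC (nabsX vLP) ler_wpM2r ?(nabs_ge0 vLP) // ltW.
Qed.

(** A lower bound for monomials with exponents in [[-1, 1]]: one factor for the numerator, one for
    the power of the product of the generators. *)
Let rho := (\prod_(i < l) r i) * \prod_(i < l) r i.

Let prod_r_gt0 : 0 < \prod_(i < l) r i.
Proof. by apply: prodr_gt0 => i _; case/andP: (r01 i). Qed.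

Let abs_X : vL X = \prod_(i < l) r i.
Proof.
rewrite (nabs_prod vLP); apply: eq_bigr => i _.
by rewrite -(Kperfd_abs_genX vP r01 LP i 0) expn0 expr1.
Qed.

Let abs_X_le1 : vL X <= 1.
Proof. by rewrite abs_X; apply: prodr_ile1 => i _; case/andP: (r01 i) => /ltW -> ->. Qed.

(** Multiplying by [X] makes all exponents nonnegative, so the root is [f b * X^-1] for a monomial
    [b] in the unit ball of [A], and the approximation of [X^-1] carries over with the same
    constant. *)
Lemma small_monomial_approximable C0 q h : (index_size q <= p ^ h)%N ->
  app C0 (eps * vL X^-1) X^-1 ->
  app C0 (eps * vL (monomial_root q h)) (monomial_root q h) /\ rho <= vL (monomial_root q h).
Proof.
move=> size_q appX; have hm : (q.2 <= p ^ h)%N by apply: leq_trans size_q; apply: leq_addl.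
pose b := (\prod_(i < l) T i (q.1.1 + h) ^+ q.1.2 i) * (\prod_(i < l) T i h) ^+ (p ^ h - q.2).
have b1 : nA b <= 1.
  apply: snormM_le1 => //; first by apply: snorm_prod_le1 => // i _; apply: snormX_le1.
  by apply: snormX_le1 => //; apply: snorm_prod_le1.
have fbE : f b = root_monomial x (q.1.1 + h) q.1.2 * root_prod x h ^+ (p ^ h - q.2).
  rewrite rmorphM rmorphXn !rmorph_prod; congr (_ * _ ^+ _).
    by apply: eq_bigr => i _; rewrite rmorphXn fT.
  by apply: eq_bigr => i _; rewrite fT.
have monE : monomial_root q h = f b * X^-1.
  rewrite fbE /X -(root_prodX h) -{2}(subnK hm) exprD /monomial_root.
  have := root_prod_neq0 vP r01 LP h => Xh0.
  by field; rewrite !expf_neq0.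
split.
  by rewrite monE (nabsM vLP) mulrCA; apply: approximableM.
rewrite monE (nabsM vLP) (nabsV vLP).
have fb0 := nabs_ge0 vLP (f b).
apply: (@le_trans _ _ (vL (f b))); last first.
  rewrite ler_pdivlMr ?abs_X // ler_piMr // -abs_X //.
rewrite fbE (nabsM vLP); apply: ler_pM; rewrite ?(ltW prod_r_gt0) //.
  rewrite (nabs_prod vLP); apply: ler_prod => i _.
  case/andP: (r01 i) => /ltW -> _ /=.
  rewrite (nabsX vLP) -(Kperfd_abs_genX vP r01 LP i (q.1.1 + h)).
  apply: ler_wiXn2l; rewrite ?(nabs_ge0 vLP) ?(Kperfd_abs_gen_le1 pr vP r01 LP) //.
  apply: (@leq_trans (p ^ h)); last by rewrite leq_pexp2l // leq_addl.
  apply: leq_trans size_q; apply: leq_trans (leq_addr _ _); exact: leq_bigmax.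
rewrite -abs_X /X -(root_prodX h) !(nabsX vLP).
apply: ler_wiXn2l; rewrite ?(nabs_ge0 vLP) ?leq_subr //.
rewrite (nabs_prod vLP); apply: prodr_ile1 => i _.
by rewrite (nabs_ge0 vLP) (Kperfd_abs_gen_le1 pr vP r01 LP).
Qed.

Lemma gterm_approximable : exists2 C1, 0 <= C1 & forall j, app C1 eps (gterm j 0).
Proof.
have [C0 appX] := root_prod_inv_approximable.
have C0_ge0 : 0 <= C0 by case: appX => a [h _]; apply: le_trans h.
have rho0 : 0 < rho by rewrite mulr_gt0.
have small j h : (index_size (idx j) <= p ^ h)%N -> app (C0 / rho) eps (gterm j h).
  move=> hs; have [ap lo] := small_monomial_approximable hs appX.
  have := gterm_le1 j h; rewrite {1}/gterm (nabsM vLP) vLi => t1.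
  have v0 := nabs_ge0 vP (pi h ^ ex j).
  (* The term is at most 1 and its monomial at least [rho], so its scalar is at most [rho^-1],
     uniformly in [j] and [h]. *)
  apply: approximable_le (approximableZ vP vLP vLi nAZ fi (pi h ^ ex j) ap).
    rewrite mulrC ler_wpM2l // -[rho^-1]mul1r ler_pdivlMr //.
    by apply: le_trans t1; rewrite ler_wpM2l.
  by rewrite mulrCA ler_piMr // ltW.
exists (Num.max 1 (C0 / rho)); first by rewrite le_max ler01.
move=> j; pose P (i : 'I_(level j).+1) := (level i <= level j)%N && (i != j :> nat).
(* At its own level, term [j] appears without a root. The whole sum is within [eps] of the image of
   [S (level j)], and every other term present has index below [j], hence is small in the above
   sense. *)
have -> : gterm j 0 = partial_sum (level j) -
    \sum_(i < (level j).+1 | P i) gterm i (level j - level i).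
  have jl : (j < (level j).+1)%N by rewrite ltnS leq_level.
  by rewrite /partial_sum (bigD1 (Ordinal jl)) //= subnn addrK.
apply: approximableB => //.
  exists (S (level j)); rewrite fS le_max S1 (unorm_distC vLU); split => //.
apply: approximable_sum => //; first by rewrite le_max ler01.
  exact: ltW.
move=> i /andP[h1 h2].
apply: (approximable_le (C := C0 / rho) (d := eps)) => //; first by rewrite le_max lexx orbT.
apply: small; have := level_ltn (level_inj_leq h1 h2) => h.
apply: (@leq_trans (level j - level i)); first by rewrite -(leq_add2l (level i)) subnKC // ltnW.
by apply: ltnW; apply: ltn_expl; apply: prime_gt1.
Qed.

(** The contraction factor is [eps / Q ^+ p.+1], below 1 because the window lies above [eps]. *)
Lemma generators_surjective : forall y, exists a, f a = y.
Proof.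
have [C1 C1_ge0 appG] := gterm_approximable.
pose c := Q ^+ p.+1.
have c0 : 0 < c by apply: exprn_gt0.
have ec : eps < c by apply: eps_lt_window.
(* The monomial is a scalar multiple of some [gterm j 0], which exceeds [c]; the scalar is therefore
   at most [B / c]. *)
have mono_app (la : K) q B : vL (iL la * monomial_root q 0) <= B ->
    app (B / c * C1) (B / c * eps) (iL la * monomial_root q 0).
  move=> hB; have [j jq] := idx_onto q.
  have d0 : pi 0%N ^ ex j != 0.
    by rewrite expfz_neq0 //; apply: contraTneq pi_gt0 => ->; rewrite (nabs0 vP) ltxx.
  have E : iL la * monomial_root q 0 = iL (la / pi 0%N ^ ex j) * gterm j 0.
    by rewrite /gterm jq mulrA -rmorphM divfK.
  have /andP[g1 _] := gterm_window j.
  have vc : v (la / pi 0%N ^ ex j) <= B / c.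
    rewrite ler_pdivlMr //; apply: le_trans hB; rewrite E (nabsM vLP) vLi.
    by rewrite ler_wpM2l ?(nabs_ge0 vP) // ltW.
  rewrite E; apply: approximable_le (approximableZ vP vLP vLi nAZ fi _ (appG j)).
    by rewrite ler_wpM2r.
  by rewrite ler_wpM2r // ltW.
have laurent_app z : is_laurent iL x z -> app (vL z / c * C1) (vL z / c * eps) z.
  move=> [m [k [D [b E]]]].
  have Xm0 : X ^+ m != 0 by rewrite expf_neq0.
  pose q (e : {ffun 'I_l -> 'I_D}) : monomial_index := (k, [ffun i => e i : nat], m).
  have mE (e : {ffun 'I_l -> 'I_D}) :
      monomial_root (q e) 0 = root_monomial x k (fun i => e i) / X ^+ m.
    rewrite /monomial_root /= addn0; congr (_ / _).
    by apply: eq_bigr => i _; rewrite ffunE.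
  have zE : z = \sum_(e : {ffun 'I_l -> 'I_D}) iL (b e) * monomial_root (q e) 0.
    apply: (mulIf Xm0); rewrite E /poly_expr mulr_suml; apply: eq_bigr => e _.
    by rewrite mE mulrA mulfVK.
  have z0 := nabs_ge0 vLP z.
  rewrite {3}zE; apply: approximable_sum => //.
  - by rewrite mulr_ge0 // divr_ge0 // ltW.
  - by rewrite mulr_ge0 ?divr_ge0 // ltW.
  (* There is no cancellation: the Gauss norm of the numerator dominates each of its terms, so each
     term of [z] is at most [vL z]. *)
  move=> e _; apply: mono_app.
  rewrite mE mulrA (nabsM vLP) (nabsV vLP) ler_pdivrMr ?(nabs_gt0 vLP) // -(nabsM vLP) E.
  case: LP => _ [_ _ _ -> _]; apply: le_trans (le_bigmax _ _ e).
  rewrite (nabsM vLP) vLi ler_wpM2l ?(nabs_ge0 vP) // (nabs_prod vLP).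
  by apply: ler_prod => i _; rewrite (nabs_ge0 vLP) (nabsX vLP) (Kperfd_abs_gen vP LP) lexx.
have t01 : 0 <= eps / c < 1.
  by rewrite divr_ge0 ?ltW //= ltr_pdivrMr // mul1r.
apply: (surjective_of_approximation (C := C1 / c) nAU cplA vLP fb _ t01).
  by rewrite divr_ge0 // ltW.
move=> y; have [->|y0] := eqVneq y 0.
  by exists 0; rewrite rmorph0 subrr (nabs0 vLP) !mulr0 (unorm0 nAU).
have vy := nabs_gt0 vLP y0.
have t0 : 0 < eps / c by rewrite divr_gt0.
have [z zl zy] := laurent_dense pr vP r01 free LP y (mulr_gt0 t0 vy).
have zE : vL z = vL y.
  apply: (unorm_closest vLU); rewrite (unorm_distC vLU); apply: lt_trans zy _.
  by rewrite gtr_pMl //; case/andP: t01.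
have [a [h1 h2]] := laurent_app z zl; exists a; split.
  by rewrite (_ : C1 / c * vL y = vL z / c * C1) // zE; ring.
apply: (@unorm_trans _ _ _ vLU _ z); first exact: ltW.
by rewrite (_ : eps / c * vL y = vL z / c * eps) // zE; ring.
Qed.
End Generators.

(** * The surjection and the two assertions *)

Lemma tate_surjects_onto_Kperfd (R : realType) (p : nat) (K : fieldType) (v : K -> R)
    (m l : nat) (r : 'I_l -> R) :
  perfectoid_field p v -> (l < m)%N ->
  (forall i, (0 < r i) && (r i <= 1)) -> K_free v r ->
  forall (L : fieldType) (iL : {rmorphism K -> L}) (vL : L -> R) (x : 'I_l -> nat -> L),
  is_Kperfd p v r iL vL x ->
  forall (A : comNzRingType) (iA : {rmorphism K -> A}) (nA : A -> R) (t : 'I_m -> nat -> A),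
  is_perfd_tate p v iA nA t ->
  exists f : {rmorphism A -> L},
    [/\ K_linear_hom iA iL f, continuous_wrt nA vL f & forall y, exists a, f a = y].
Proof.
move=> Kp lm r01 free L iL vL x LP A iA nA t AP.
have [pi [piS pi0 pi1 pip]] := perfectoid_pseudo_uniformizer Kp.
have [pr [vP _ _ _ _]] := Kp.
have [vLP [cplL vLi xS _ _]] := LP.
(* Index 0 is reserved for the inverse of the product of the generators, which also serves as the
   default for codes that decode to nothing. *)
pose idx j : monomial_index l := if j is j'.+1
  then odflt (0%N, [ffun=> 0%N], 1%N) (unpickle j') else (0%N, [ffun=> 0%N], 1%N).
have idx_onto q : exists j, idx j = q by exists (pickle q).+1; rewrite /idx pickleK.
have window j : exists a : int, v (pi 0%N) ^+ p.+1 <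
    vL (iL (pi 0%N ^ a) * monomial_root x (idx j) 0) <= v (pi 0%N) ^+ p.
  have Q01 : 0 < v (pi 0%N) < 1 by rewrite pi0.
  have mon0 : 0 < vL (monomial_root x (idx j) 0).
    by rewrite (nabs_gt0 vLP) // (monomial_root_neq0 vP r01 LP).
  have [a ha] := geometric_window Q01 (exprn_gt0 p pi0) mon0.
  by exists a; rewrite (nabsM vLP) vLi (nabsXz vP) exprSr.
have [ex exP] := choice window.
have [s [sS s1 s_close]] := universal_root_exists pr LP piS pi0 pi1 pip exP.
(* The first [l] variables go to the [x i]; all further ones go to [s]. *)
pose g (i : 'I_m) k := if insub (i : nat) is Some i' then x i' k else s k.
have gS i k : g i k.+1 ^+ p = g i k by rewrite /g; case: insub.
have g1 i k : vL (g i k) <= 1.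
  by rewrite /g; case: insub => // i'; apply: (Kperfd_abs_gen_le1 pr vP r01 LP).
have [f [fi ft fb]] := tate_hom_exists vP AP vLP cplL vLi gS g1.
have nAU := tate_norm_ultrametric vP AP.
have [[_ _ _ nAZ nAM] [cplA _ gauss _]] := AP.
have t1 i k : nA (t i k) <= 1 by rewrite (gauss_norm_gen vP gauss) powR1.
have nA1 : nA 1 <= 1.
  have := gauss 0%N 1%N (fun e => (e == [ffun=> ord0])%:R).
  rewrite poly_expr_delta gauss_val_delta // /root_monomial !big1 => [->//|i _|i _].
    by rewrite ffunE expr0.
  by rewrite ffunE expr0.
exists f; split=> //.
  move=> y e e0; exists e; split=> // z zy.
  by rewrite -rmorphB; apply: le_lt_trans (fb _) zy.
apply: (generators_surjective pr vP r01 free LP piS pi0 pi1 pip exP nAU nAZ nAM nA1 cplA fi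
  (T := fun i k => t (widen_ord (ltnW lm) i) k) (S := t (Ordinal lm)) (s := s)) => //.
  by move=> i k; rewrite ft /g [insub _](valK i).
by move=> k; rewrite ft /g insubF //= ltnn.
Qed.

Theorem theorem7p1 (R : realType) (p : nat) (K : fieldType) (v : K -> R)
  (n l : nat) (r : 'I_l -> R) :
  perfectoid_field p v -> (1 <= n)%N -> (l <= n)%N ->
  (forall i, (0 < r i) && (r i <= 1)) -> K_free v r ->
  forall (L : fieldType) (iL : {rmorphism K -> L}) (vL : L -> R)
         (x : 'I_l -> nat -> L),
  is_Kperfd p v r iL vL x ->
  (forall (A : comNzRingType) (iA : {rmorphism K -> A}) (nA : A -> R)
          (t : 'I_(n.+2) -> nat -> A),
     is_perfd_tate p v iA nA t ->
     exists f : {rmorphism A -> L},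
       [/\ K_linear_hom iA iL f, continuous_wrt nA vL f
         & forall y, exists a, f a = y]) /\
  (l = n ->
   forall (A : comNzRingType) (iA : {rmorphism K -> A}) (nA : A -> R)
          (t : 'I_(n.+1) -> nat -> A),
     is_perfd_tate p v iA nA t ->
     exists g : {rmorphism A -> L},
       [/\ K_linear_hom iA iL g, continuous_wrt nA vL g,
           (forall a, g a != 0 -> exists b, g b = (g a)^-1)
         & finite_separable_over (fun y => exists a, g a = y)]).
Proof.
move=> Kp _ ln r01 free L iL vL x LP; split=> [A iA nA t AP|_ A iA nA t AP].
  exact: (tate_surjects_onto_Kperfd Kp (leqW ln : l < n.+2)%N r01 free LP AP).
have [g [gi gc gonto]] := tate_surjects_onto_Kperfd Kp (ln : l < n.+1)%N r01 free LP AP.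
exists g; split=> //; split=> [|y].
  (* The image of [g] is all of [L], so [1] spans and ['X - y%:P] has its coefficients in the
     image. *)
  exists [:: 1] => y; exists (fun=> y); split=> //.
  by rewrite big_ord1 mulr1.
exists ('X - y%:P); split=> //; first by rewrite polyXsubC_eq0.
  by rewrite root_XsubC.
by rewrite separable_poly.unlock derivB derivX derivC subr0 coprimep1.
Qed.
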